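(* Let $T$ be an operator acting on measurable functions on $\mathbb{R}^n$, and suppose that for some $1<p_0<\infty$, some constant $c>0$ and some $\beta>0$, \[ \|T\|_{L^{p_0}(w)\to L^{p_0,\infty}(w)}\le c\,[w]_{A_{p_0}}^{\beta}\qquad\text{for every } w\in A_{p_0}. \] Then \[ \beta\ \ge\ \max\Big\{\gamma_T,\ \frac{\alpha_T}{p_0-1}\Big\}, \] where \[ \alpha_T=\sup\Big\{\alpha\ge 0:\ \forall\varepsilon>0,\ \limsup_{p\to1^+}(p-1)^{\alpha-\varepsilon}\|T\|_{L^p\to L^{p,\infty}}=\infty\Big\}, \qquad \gamma_T=\sup\Big\{\gamma\ge 0:\ \forall\varepsilon>0,\ \limsup_{p\to\infty}\frac{\|T\|_{L^p\to L^{p,\infty}}}{p^{\gamma-\varepsilon}}=\infty\Big\}, \] with the convention $\sup\emptyset=0$, and $\|T\|_{L^p\to L^{p,\infty}}$ denotes the (possibly infinite) operator norm from unweighted $L^p(\mathbb{R}^n)$ to unweighted $L^{p,\infty}(\mathbb{R}^n)$.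
   Context: A weight is a non-negative locally integrable function on $\mathbb{R}^n$. For $1<p<\infty$, $w\in A_p$ means $[w]_{A_p}=\sup_Q\big(\frac{1}{|Q|}\int_Q w\big)\big(\frac{1}{|Q|}\int_Q w^{-\frac{1}{p-1}}\big)^{p-1}<\infty$, the supremum over all cubes $Q$ with sides parallel to the axes. $L^{p,\infty}(w)$ is the weak Lebesgue space with quasi-norm $\|g\|_{L^{p,\infty}(w)}=\sup_{\lambda>0}\lambda\, w(\{x:|g(x)|>\lambda\})^{1/p}$, and $\|T\|_{L^{p}(w)\to L^{p,\infty}(w)}=\sup\{\|Tf\|_{L^{p,\infty}(w)}:\|f\|_{L^p(w)}\le1\}$. *)

(* Defs.v *)
From HB Require Import structures.
From mathcomp Require Import all_boot all_order all_algebra.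
From mathcomp Require Import all_classical all_reals all_analysis.
Import Order.TTheory GRing.Theory Num.Theory.
Set Implicit Arguments. Unset Strict Implicit. Unset Printing Implicit Defensive.
Local Open Scope classical_set_scope.
Local Open Scope ring_scope.

(* Lebesgue measure on R^n = n.-tuple R (with its product = Borel      *)
(* sigma-algebra), built as the iterated product lebesgue \x ...       *)
Section lebesgue_n.
Context (R : realType).

Definition tcons (n : nat) (p : (R * n.-tuple R)%type) : n.+1.-tuple R :=
  [tuple of p.1 :: p.2].
Definition tuncons (n : nat) (t : n.+1.-tuple R) : (R * n.-tuple R)%type :=
  (thead t, [tuple of behead t]).

Lemma tunconsK (n : nat) : cancel (@tcons n) (@tuncons n).
Proof. by case=> x t; rewrite /tuncons /tcons /=; congr pair; apply/val_inj. Qed.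

Lemma measurable_tcons (n : nat) : measurable_fun [set: (R * n.-tuple R)%type] (@tcons n).
Proof. exact: (measurable_cons measurable_fst measurable_snd). Qed.

Lemma measurable_tuncons (n : nat) : measurable_fun [set: n.+1.-tuple R] (@tuncons n).
Proof.
apply: measurable_fun_pair; first exact: measurable_tnth.
exact: measurable_behead.
Qed.

Section pf.
Context (n : nat) (m1 : {sigma_finite_measure set (measurableTypeR R) -> \bar R})
  (m2 : {sigma_finite_measure set (n.-tuple R) -> \bar R}).

Local Notation m := (m1 \x m2)%E.

Let m_sigma_finite : sigma_finite setT m.
Proof.
have /sigma_finiteP[F [TF ndF Foo]] := sigma_finiteT m1.
have /sigma_finiteP[G [TG ndG Goo]] := sigma_finiteT m2.
exists (fun i => F i `*` G i).
  rewrite -setXTT TF TG predeqE => -[x y]; split.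
    move=> [/= [i _ Fnx] [k _ Gky]]; exists (maxn i k) => //; split.
    - by move: x Fnx; exact/subsetPset/ndF/leq_maxl.
    - by move: y Gky; exact/subsetPset/ndG/leq_maxr.
  by move=> [i _ []/= ? ?]; split; exists i.
move=> k; have [? ?] := Foo k; have [? ?] := Goo k.
split; first exact: measurableX.
by rewrite product_measure1E// lte_mul_pinfty// ge0_fin_numE.
Qed.

Definition pf_cons : set (n.+1.-tuple R) -> \bar R := pushforward m (@tcons n).

Let pf0 : pf_cons set0 = 0%E.
Proof. by rewrite /pf_cons /pushforward preimage_set0 measure0. Qed.

Let pf_ge0 A : (0 <= pf_cons A)%E.
Proof. exact: (measure_ge0 m). Qed.

Let pf_sigma_additive : semi_sigma_additive pf_cons.
Proof.
have mf := @measurable_tcons n.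
move=> F mF tF mUF; rewrite /pf_cons /pushforward preimage_bigcup.
apply: measure_semi_sigma_additive.
- by move=> k; rewrite -[X in measurable X]setTI; exact: mf.
- apply/trivIsetP => /= i j _ _ ij; rewrite -preimage_setI.
  by move/trivIsetP : tF => /(_ _ _ _ _ ij) ->//; rewrite preimage_set0.
- by rewrite -preimage_bigcup -[X in measurable X]setTI; exact: mf.
Qed.

HB.instance Definition _ := isMeasure.Build _ _ _ pf_cons pf0 pf_ge0
  pf_sigma_additive.

Let pf_sigma_finite : sigma_finite setT pf_cons.
Proof.
have [F FT Ffin] := m_sigma_finite.
exists (fun k => @tuncons n @^-1` F k).
  by rewrite -preimage_bigcup -FT preimage_setT.
move=> k; split.
  rewrite -[X in measurable X]setTI; apply: measurable_tuncons => //.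
  by case: (Ffin k).
rewrite /pf_cons /pushforward.
have -> : @tcons n @^-1` (@tuncons n @^-1` F k) = F k.
  by apply/seteqP; split => p /=; rewrite tunconsK.
by case: (Ffin k).
Qed.

HB.instance Definition _ := Measure_isSigmaFinite.Build _ _ _ pf_cons
  pf_sigma_finite.

End pf.

Fixpoint lebesgue_n (n : nat) : {sigma_finite_measure set (n.-tuple R) -> \bar R} :=
  match n return {sigma_finite_measure set (n.-tuple R) -> \bar R} with
  | 0 => \d_([tuple] : 0.-tuple R)
  | n'.+1 => @pf_cons n' (@lebesgue_measure R) (lebesgue_n n')
  end.

End lebesgue_n.

Section weights.
Context (R : realType) (n : nat).
Local Notation Rn := (n.-tuple R).
Local Notation leb := (lebesgue_n R n).
Local Open Scope ereal_scope.

Definition cube (a : Rn) (l : R) : set Rn :=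
  [set x | forall i : 'I_n, (tnth a i <= tnth x i <= tnth a i + l)%R].

(* average of a nonnegative extended-real function over cube a l;
   |cube a l| = l^n *)
Definition cube_avg (f : Rn -> \bar R) (a : Rn) (l : R) : \bar R :=
  ((l ^+ n)^-1)%:E * \int[leb]_(x in cube a l) f x.

Definition is_weight (w : Rn -> R) : Prop :=
  (forall x, (0 <= w x)%R) /\ measurable_fun setT w /\
  (forall a l, (0 < l)%R -> \int[leb]_(x in cube a l) (w x)%:E < +oo).

Definition dual_weight (p : R) (w : Rn -> R) (x : Rn) : \bar R :=
  if w x == 0%R then +oo else (w x `^ (- (p - 1)^-1))%:E.

Definition Ap_char (p : R) (w : Rn -> R) : \bar R :=
  ereal_sup [set cube_avg (EFin \o w) a l *
                 poweR (cube_avg (dual_weight p w) a l) (p - 1)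
            | a in [set: Rn] & l in [set l : R | (0 < l)%R]].

Definition in_Ap (p : R) (w : Rn -> R) : Prop :=
  is_weight w /\ Ap_char p w < +oo.

Definition Lp_norm (p : R) (w : Rn -> R) (f : Rn -> R) : \bar R :=
  poweR (\int[leb]_x ((`|f x| `^ p) * w x)%:E) p^-1.

Definition weakLp_norm (p : R) (w : Rn -> R) (g : Rn -> R) : \bar R :=
  ereal_sup [set lam%:E *
                 poweR (\int[leb]_(x in [set x | (lam < `|g x|)%R]) (w x)%:E) p^-1
            | lam in [set lam : R | (0 < lam)%R]].

Definition op_norm (p : R) (w : Rn -> R) (T : (Rn -> R) -> Rn -> R) : \bar R :=
  ereal_sup [set weakLp_norm p w (T f)
            | f in [set f : Rn -> R | measurable_fun setT f /\ Lp_norm p w f <= 1]].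

Definition op_norm_unw (p : R) (T : (Rn -> R) -> Rn -> R) : \bar R :=
  op_norm p (fun _ => 1%R) T.

(* alpha_T and gamma_T, with the convention sup(empty) = 0 *)
Definition alpha_T (T : (Rn -> R) -> Rn -> R) : \bar R :=
  maxe 0 (ereal_sup [set a%:E | a in [set a : R | (0 <= a)%R /\
    forall eps : R, (0 < eps)%R ->
      limf_esup (fun p : R^o => ((p - 1) `^ (a - eps))%:E * op_norm_unw p T)
                (1%R : R)^'+ = +oo]]).

Definition gamma_T (T : (Rn -> R) -> Rn -> R) : \bar R :=
  maxe 0 (ereal_sup [set g%:E | g in [set g : R | (0 <= g)%R /\
    forall eps : R, (0 < eps)%R ->
      limf_esup (fun p : R^o => op_norm_unw p T * ((p `^ (g - eps))^-1)%:E)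
                (pinfty_nbhs R) = +oo]]).

End weights.

(* Main.v *)
Require Import Defs.
From mathcomp Require Import all_boot all_order all_algebra.
From mathcomp Require Import all_classical all_reals all_analysis.
From mathcomp Require Import measurable_realfun.
From mathcomp Require Import ring lra.
Import Order.TTheory GRing.Theory Num.Theory.
Local Open Scope classical_set_scope.
Local Open Scope ring_scope.

(** Rubio de Francia extrapolation read backwards. The Hardy-Littlewood maximal
    operator M satisfies int (Mf)^p <= D/(p-1) int f^p for 1 < p <= 2, so summing
    its normalized iterates produces, for F >= 0 in L^p, a majorant G >= F of
    comparable L^p norm with an A_1 bound of order 1/(p-1).

    For p near 1, take F ~ |f| and w = G^-(p0-p): then [w]_{A_p0} is at most of
    order (p-1)^-(p0-1), and w turns the L^p0(w) weak bound into an unweighted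
    weak L^p bound, so that ||T||_p <= C (p-1)^-(beta (p0-1)).

    For p large, take F a multiple of the indicator of a piece of {|Tf| > lam},
    normalized in the dual exponent q = (p/p0)', and w ~ G: then [w]_{A_p0} is
    at most of order 1/(q-1) ~ p, so that ||T||_p <= C p^beta.

    The weak L^p bounds compare distribution functions on {G <= m} and {G > m},
    which dispenses with Hoelder's inequality. *)

(** * Cubes and the covering lemma *)

Section cubes.
Context (R : realType) (n : nat).
Local Notation Rn := (n.-tuple R).
Local Notation leb := (lebesgue_n R n).

(** The two exponents differ because the A_1 bound enters [Ap_char] in two ways. A weight with A_1
    constant [A] has [Ap_char p0] at most [A], whereas a power [G^-r] with [0 < r < p0 - 1] of such
    a function has it only at most [(2A)^(p0-1)]. With [A] of order [p] in the first case and
    [1/(p-1)] in the second, the growth rates are [p^beta] and [(p-1)^-(beta (p0-1))], whence the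
    divisor [p0 - 1] under [alpha_T].

    About [T] itself only the preservation of measurability is available: [f] can be neither
    rescaled nor decomposed. Each [f], and for large [p] each bounded piece of each level set,
    therefore receives its own weight, built so that [f] stays in the unit ball of [L^p0(w)]. This
    works because [c] and [beta] are uniform in [w]. Numerical constants may be wasteful as long as
    they do not depend on [p], since [alpha_T] and [gamma_T] only detect powers. *)

Lemma measurable_cube (a : Rn) (l : R) : measurable (cube a l).
Proof.
have -> : cube a l = \bigcap_(i in [set: 'I_n])
    ((fun x : Rn => tnth x i) @^-1` `[tnth a i, tnth a i + l]%classic).
  apply/seteqP; split => x /= h i; first by move=> _; rewrite /= in_itv /=; exact: h.
  by have := h i I; rewrite /= in_itv.
apply: fin_bigcap_measurable => // i _.
rewrite -[X in measurable X]setTI; exact: (measurable_tnth i).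
Qed.

End cubes.

Lemma lebesgue_cube (R : realType) (n : nat) (a : n.-tuple R) (l : R) : 0 <= l ->
  lebesgue_n R n (cube a l) = (l ^+ n)%:E.
Proof.
move=> l0; elim: n a => [|n IH] a.
  rewrite /= diracE expr0 mem_set//=; by move=> [].
rewrite /= /pf_cons /pushforward.
have -> : @tcons R n @^-1` cube a l =
    `[thead a, thead a + l]%classic `*` cube [tuple of behead a] l.
  apply/seteqP; split => -[x t] /=.
    move=> h; split.
      by have := h ord0; rewrite /tcons !(tnth_nth 0) /= in_itv /= (tuple_eta a).
    move=> i; have := h (lift ord0 i).
    by rewrite /tcons !(tnth_nth 0) /= nth_behead.
  move=> [h1 h2] i; case: (unliftP ord0 i) => [j|] ->.
    by have := h2 j; rewrite /tcons !(tnth_nth 0) /= nth_behead.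
  by move: h1; rewrite /tcons !(tnth_nth 0) /= in_itv /= (tuple_eta a).
rewrite product_measure1E //; last exact: measurable_cube.
rewrite IH; pose J : interval R := `[thead a, thead a + l].
transitivity ((lebesgue_measure ([set` J] : set R)) * (l ^+ n)%:E)%E; first by [].
suff -> : (lebesgue_measure ([set` J] : set R) = l%:E)%E by rewrite -EFinM exprS.
rewrite lebesgue_measure_itv /=.
rewrite lte_fin ltrDl; case: ltgtP l0 => // [l0 _|<- _].
  by rewrite -EFinB addrAC subrr add0r.
by [].
Qed.

Section cubes2.
Context (R : realType) (n : nat).
Local Notation Rn := (n.-tuple R).
Local Notation leb := (lebesgue_n R n).

(** Carries the positivity of an average from one cube to every other one in [rdf_lower_bound]. The
    final [+ 1] in [r] keeps the side positive when all other data vanish. *)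
Lemma cube_hull2 (a : Rn) (l : R) (b : Rn) (m : R) : 0 <= l -> 0 <= m ->
  exists c k, [/\ 0 < k, cube a l `<=` cube c k & cube b m `<=` cube c k].
Proof.
move=> l0 m0.
pose r : R := \sum_(i < n) (`|tnth a i| + `|tnth b i|) + l + m + 1.
have hr i : `|tnth a i| + `|tnth b i| + l + m + 1 <= r.
  rewrite /r !lerD2r (bigD1 i) //= lerDl.
  by apply: sumr_ge0 => j _; rewrite addr_ge0.
have r0 : 0 < r.
  by rewrite /r ltr_wpDl // !addr_ge0 // sumr_ge0 // => i _; rewrite addr_ge0.
exists [tuple - r | i < n], (2 * r); split; first by rewrite mulr_gt0.
  move=> y /= hy i; have /andP[h1 h2] := hy i; have := hr i.
  have := ler_norm (tnth a i); have := ler_norm (- tnth a i); rewrite normrN.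
  have := normr_ge0 (tnth b i).
  rewrite tnth_mktuple => *; apply/andP; split; lra.
move=> y /= hy i; have /andP[h1 h2] := hy i; have := hr i.
have := ler_norm (tnth b i); have := ler_norm (- tnth b i); rewrite normrN.
have := normr_ge0 (tnth a i).
rewrite tnth_mktuple => *; apply/andP; split; lra.
Qed.

Lemma cube_exhaust : \bigcup_k cube [tuple - k%:R | i < n] (2 * k%:R : R) = [set: Rn].
Proof.
apply/seteqP; split => // x _.
have h i : `|tnth x i| <= \sum_(i < n) `|tnth x i|.
  rewrite (bigD1 i) //= lerDl; exact: sumr_ge0.
have [k hk] : exists k : nat, \sum_(i < n) `|tnth x i| <= k%:R.
  exists (Num.bound (\sum_(i < n) `|tnth x i|)).
  by apply/ltW/archi_boundP/sumr_ge0.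
exists k => // i; have := h i.
have := ler_norm (tnth x i); have := ler_norm (- tnth x i); rewrite normrN.
rewrite tnth_mktuple => *; apply/andP; split; lra.
Qed.

(** Cubes with rational corner and side form a sequence, so that a supremum of averages over them is
    measurable. The price is a factor 2 in the side, hence [2^n] in the averages. *)
Lemma countable_cubes : exists (a : nat -> Rn) (l : nat -> R),
  (forall k, 0 < l k) /\
  forall b m, 0 < m -> exists k, cube b m `<=` cube (a k) (l k) /\ l k <= 2 * m.
Proof.
pose I : countType := (n.-tuple rat * rat)%type.
pose c (k : nat) : n.-tuple rat * rat := odflt ([tuple 0 | i < n], 1) (@unpickle I k).
pose a k : Rn := [tuple ratr (tnth (c k).1 i) | i < n].
pose l k : R := if 0 < (c k).2 then ratr (c k).2 else 1.
exists a, l; split.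
  by move=> k; rewrite /l; case: ifPn => // h; rewrite ltr0q.
move=> b m m0.
(* The corner is moved down by less than [m / 2], so a side above [m + m / 2] still covers the
   cube. *)
have [q] := @rat_in_itvoo R (m + m / 2) (2 * m) ltac:(lra).
rewrite in_itv /= => /andP[q1 q2].
have hb i : exists s : rat, tnth b i - m / 2 < ratr s < tnth b i.
  have [s] := @rat_in_itvoo R (tnth b i - m / 2) (tnth b i) ltac:(lra).
  by rewrite in_itv /=; exists s.
have [s hs] := choice hb.
pose j : I := ([tuple s i | i < n], q).
have q0 : 0 < q by rewrite -(ltr0q R); lra.
exists (pickle j); rewrite /a /l /c pickleK /= q0; split; last exact: ltW.
move=> x /= hx i; have /andP[h1 h2] := hx i; have /andP[h3 h4] := hs i.
rewrite tnth_mktuple tnth_mktuple; apply/andP; split; lra.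
Qed.

Local Open Scope ereal_scope.

(* Vitali's selection: keep a largest cube, discard the cubes that meet it (they lie
   in its threefold dilate), and recurse. *)
Lemma greedy_covering (f : Rn -> \bar R) (t : R) (s : seq (Rn * R)) :
  (forall x, 0 <= f x) -> measurable_fun setT f -> (0 <= t)%R ->
  (forall q, q \in s -> (0 < q.2)%R /\ (t * q.2 ^+ n)%:E <= \int[leb]_(x in cube q.1 q.2) f x) ->
  t%:E * leb (\big[setU/set0]_(q <- s) cube q.1 q.2) <=
    (3 ^+ n)%:E * \int[leb]_(x in \big[setU/set0]_(q <- s) cube q.1 q.2) f x.
Proof.
move=> f0 mf t0; have [N] := ubnP (size s); elim: N s => // N IH s sN hs.
case: s sN hs => [|q0 s0] sN hs; first by rewrite !big_nil measure0 mule0 integral_set0 mule0.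
move: sN hs; set s := _ :: s0 => sN hs.
have mU (r : seq (Rn * R)) : measurable (\big[setU/set0]_(q <- r) cube q.1 q.2).
  apply: bigsetU_measurable => i _; exact: measurable_cube.
have [qm qms qmax] : exists2 qm, qm \in s & forall q, q \in s -> (q.2 <= qm.2)%R.
  rewrite /s; elim: (s0) (q0) => [|b r IHr] a.
    by exists a; rewrite ?mem_head // => q; rewrite inE => /eqP ->.
  have [qm qmr hq] := IHr b.
  case: (leP a.2 qm.2) => h.
    exists qm; first by rewrite inE qmr orbT.
    by move=> q; rewrite inE => /predU1P[->|/hq].
  exists a; first exact: mem_head.
  by move=> q; rewrite inE => /predU1P[->//|/hq h']; apply: le_trans h' (ltW h).
pose Q := cube qm.1 qm.2.
pose P (q : Rn * R) := `[< cube q.1 q.2 `&` Q = set0 >].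
pose s' := [seq q <- s | P q].
have qm0 := (hs _ qms).1.
(* [Q] is nonempty, so [qm] meets itself and is discarded: the recursion runs on a strictly shorter
   list. *)
have [x0 x0Q] : exists x, Q x.
  by exists qm.1 => i; rewrite lexx lerDl ltW.
have size' : (size s' < N)%N.
  apply: (@leq_trans (size s)); last by rewrite -ltnS.
  rewrite size_filter.
  rewrite -(count_predC P s) -addn1 leq_add2l -has_count; apply/hasP; exists qm => //=.
  apply/asboolPn; rewrite setIid => h; by have : set0 x0 by rewrite -h.
have hs' q : q \in s' -> (0 < q.2)%R /\ (t * q.2 ^+ n)%:E <= \int[leb]_(x in cube q.1 q.2) f x.
  by rewrite mem_filter => /andP[_ /hs].
have {IH} IH := IH s' size' hs'.
pose Q3 := cube [tuple (tnth qm.1 i - qm.2)%R | i < n] (3 * qm.2).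
have cover : \big[setU/set0]_(q <- s) cube q.1 q.2 `<=`
    Q3 `|` \big[setU/set0]_(q <- s') cube q.1 q.2.
  rewrite -!bigcup_seq => x [q /= qs qx].
  case: (pselect (cube q.1 q.2 `&` Q = set0)) => [h|/eqP/set0P[y [/= yq yQ]]].
    by right; exists q => //=; rewrite mem_filter qs andbT; apply/asboolP.
  left => i; have := qmax _ qs; have /andP[? ?] := qx i; have /andP[? ?] := yq i.
  have /andP[? ?] := yQ i => ?.
  rewrite tnth_mktuple; apply/andP; split; lra.
have sub : Q `|` \big[setU/set0]_(q <- s') cube q.1 q.2 `<=`
    \big[setU/set0]_(q <- s) cube q.1 q.2.
  rewrite -!bigcup_seq => x [Qx|[q /= qs qx]]; first by exists qm.
  by exists q => //=; move: qs; rewrite mem_filter => /andP[].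
have mQ : measurable Q by exact: measurable_cube.
have mQ3 : measurable Q3 by exact: measurable_cube.
apply: (@le_trans _ _ (t%:E * (leb Q3 + leb (\big[setU/set0]_(q <- s') cube q.1 q.2)))).
  apply: lee_wpmul2l; first by rewrite lee_fin.
  apply: (le_trans _ (measureU2 _ mQ3 (mU s'))).
  by apply: le_measure; rewrite ?inE //; apply: measurableU.
rewrite ge0_muleDr //.
apply: (@le_trans _ _ ((3 ^+ n)%:E * (\int[leb]_(x in Q) f x +
   \int[leb]_(x in \big[setU/set0]_(q <- s') cube q.1 q.2) f x))).
  rewrite ge0_muleDr; [|exact: integral_ge0..].
  apply: leeD => //.
  rewrite lebesgue_cube; last by rewrite mulr_ge0 // ltW.
  have [_ h] := hs _ qms; rewrite exprMn -EFinM mulrCA EFinM.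
  by apply: lee_wpmul2l => //; rewrite lee_fin exprn_ge0.
apply: lee_wpmul2l; first by rewrite lee_fin exprn_ge0.
rewrite -ge0_integral_setU //.
- apply: ge0_subset_integral => //; first exact: measurableU.
  exact: measurable_funTS.
- exact: measurable_funTS.
- apply/disj_setPS => x [Qx]; rewrite -bigcup_seq => -[q /= qs qx].
  move: qs; rewrite mem_filter => /andP[/asboolP h _].
  by have : set0 x by rewrite -h.
Qed.

End cubes2.

(** * The maximal operator *)

Section maximal.
Context (R : realType) (n : nat) (a : nat -> n.-tuple R) (l : nat -> R).
Hypothesis l_gt0 : forall k, 0 < l k.
Local Notation Rn := (n.-tuple R).
Local Notation leb := (lebesgue_n R n).
Local Open Scope ereal_scope.

Lemma cube_avg_ge0 (f : Rn -> \bar R) b m : (forall x, 0 <= f x) -> (0 < m)%R ->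
  0 <= cube_avg f b m.
Proof.
move=> f0 m0; apply: mule_ge0; last exact: integral_ge0.
by rewrite lee_fin invr_ge0 exprn_ge0 // ltW.
Qed.

Lemma cube_avg_le (f g : Rn -> \bar R) b m : (0 < m)%R ->
  (forall x, 0 <= f x) -> measurable_fun setT f -> measurable_fun setT g ->
  (forall x, cube b m x -> f x <= g x) -> cube_avg f b m <= cube_avg g b m.
Proof.
move=> m0 f0 mf mg fg; apply: lee_wpmul2l.
  by rewrite lee_fin invr_ge0 exprn_ge0 // ltW.
apply: ge0_le_integral => //; first exact: measurable_cube.
- exact: measurable_funTS.
- exact: measurable_funTS.
Qed.

Lemma integral_cst_cube (K : \bar R) (b : Rn) m : (0 < m)%R ->
  \int[leb]_(x in cube b m) K = K * (m ^+ n)%:E.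
Proof.
move=> m0; rewrite integral_cst; last exact: measurable_cube.
congr (_ * _); exact: lebesgue_cube (ltW m0).
Qed.

Lemma cube_avg_cst (K : \bar R) (b : Rn) m : (0 < m)%R -> cube_avg (cst K) b m = K.
Proof.
move=> m0; rewrite /cube_avg integral_cst_cube // muleCA -EFinM mulVf ?mule1 //.
by rewrite expf_neq0 // gt_eqF.
Qed.

(* Uncentered maximal function over a sequence of cubes; the sequence given by
   [countable_cubes] makes it comparable to the one over all cubes. *)
Definition maximal (f : Rn -> \bar R) (x : Rn) : \bar R :=
  ereal_sup (range (fun k => cube_avg f (a k) (l k) * (\1_(cube (a k) (l k)) x)%:E)).

Lemma maximal_ge0 f x : (forall x, 0 <= f x) -> 0 <= maximal f x.
Proof.
move=> f0; apply: (@le_trans _ _ (cube_avg f (a 0) (l 0) * (\1_(cube (a 0) (l 0)) x)%:E)).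
  by rewrite mule_ge0 ?cube_avg_ge0 ?lee_fin.
by apply: ereal_sup_ubound; exists 0%N.
Qed.

Lemma measurable_maximal f : measurable_fun setT (maximal f).
Proof.
pose h k x := cube_avg f (a k) (l k) * (\1_(cube (a k) (l k)) x)%:E.
have -> : maximal f = (fun x => esups (h ^~ x) 0%N).
  apply/funext => x; rewrite /esups /sdrop /maximal; congr ereal_sup.
  by apply/seteqP; split => _ [k _ <-]; exists k.
apply: measurable_fun_esups => k; apply: emeasurable_funM => //.
apply: measurableT_comp => //; apply: measurable_indic; exact: measurable_cube.
Qed.

Lemma cube_avg_le_maximal (f : Rn -> \bar R) (c : R) b m x :
  (forall x, 0 <= f x) -> measurable_fun setT f ->
  (exists k, cube b m `<=` cube (a k) (l k) /\ l k <= c * m)%R ->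
  (0 < m)%R -> cube b m x -> cube_avg f b m <= (c ^+ n)%:E * maximal f x.
Proof.
move=> f0 mf [k [bk lk]] m0 bx; have lk0 := l_gt0 k.
have c0 : (0 < c)%R by rewrite -(pmulr_lgt0 _ m0) (lt_le_trans lk0).
apply: (@le_trans _ _ ((c ^+ n)%:E * cube_avg f (a k) (l k))).
  rewrite /cube_avg muleA -EFinM.
  apply: lee_pmul.
  - by rewrite lee_fin invr_ge0 exprn_ge0 // ltW.
  - exact: integral_ge0.
  - rewrite lee_fin -[leLHS]mul1r -[X in (X * _)%R](@mulfV _ (l k ^+ n)%R) ?expf_neq0 ?gt_eqF //.
    rewrite mulrAC ler_pM2r ?invr_gt0 ?exprn_gt0 // ler_pdivrMr ?exprn_gt0 //.
    by rewrite -exprMn lerXn2r ?nnegrE ?mulr_ge0 // ltW.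
  - apply: ge0_subset_integral => //; [exact: measurable_cube..|exact: measurable_funTS].
apply: lee_wpmul2l; first by rewrite lee_fin exprn_ge0 // ltW.
apply: ereal_sup_ubound; exists k => //.
by rewrite indicE mem_set ?mule1 //; exact: bk.
Qed.

(** Gives the boundedness clause of [rubio_de_francia], through which the weights for large
    exponents are finite-valued. *)
Lemma maximal_le_cst f (K : R) : (forall x, 0 <= f x) -> measurable_fun setT f ->
  (forall x, f x <= K%:E) -> forall x, maximal f x <= K%:E.
Proof.
move=> f0 mf fK x; apply: ge_ereal_sup => _ [k _ <-].
have K0 : 0 <= K%:E by apply: le_trans (fK x).
rewrite indicE; case: (_ \in _); last by rewrite mule0.
rewrite mule1 -[leRHS](@cube_avg_cst _ (a k) (l k)) //.
apply: cube_avg_le => //.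
Qed.

(** The right-hand side only sees [f] where [2 f > t]. This truncated form, as in Marcinkiewicz
    interpolation, is what can be summed over levels [t]. *)
Lemma maximal_weak_type f (t : R) : (forall x, 0 <= f x) -> measurable_fun setT f ->
  (0 < t)%R ->
  (t / 2)%:E * leb [set x | t%:E < maximal f x] <=
    (3 ^+ n)%:E * \int[leb]_(x in [set x | t%:E < 2%:E * f x]) f x.
Proof.
move=> f0 mf t0.
set A := [set x | t%:E < 2%:E * f x].
have mA : measurable A.
  rewrite -[A]setTI; apply: emeasurable_fun_o_infty => //.
  exact: measurable_funeM.
(* The covering lemma takes a finite list, so the level set is exhausted by the unions [E K] of the
   cubes of index below [K] whose average exceeds [t]. *)
pose S K := [seq (a k, l k) | k <- iota 0 K & t%:E < cube_avg f (a k) (l k)].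
pose E K : set Rn := \big[setU/set0]_(q <- S K) cube q.1 q.2.
have mE K : measurable (E K).
  apply: bigsetU_measurable => q _; exact: measurable_cube.
have EP K x : E K x <-> exists k, [/\ (k < K)%N, t%:E < cube_avg f (a k) (l k) & cube (a k) (l k) x].
  rewrite /E -bigcup_seq; split.
    move=> [q /= /mapP[k]]; rewrite mem_filter mem_iota add0n => /andP[? /andP[_ ?]] -> ?.
    by exists k.
  move=> [k [? ? ?]]; exists (a k, l k) => //=; apply/mapP; exists k => //.
  by rewrite mem_filter mem_iota add0n; apply/and3P.
have -> : [set x | t%:E < maximal f x] = \bigcup_K E K.
  apply/seteqP; split => x /=.
    move=> /ereal_sup_gt[_ [k _ <-]].
    rewrite indicE; case: (boolP (x \in _)) => [|_]; last first.
      by rewrite mule0 lte_fin ltNge ltW.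
    by rewrite inE mule1 => kx tk; exists k.+1 => //; apply/EP; exists k.
  move=> [K _ /EP[k [_ tk kx]]]; apply: (lt_le_trans tk); apply: ereal_sup_ubound.
  by exists k => //; rewrite indicE mem_set ?mule1.
(* Where [2 f <= t] the function [f] contributes at most [t / 2] to an average. *)
have Ebound K : (t / 2)%:E * leb (E K) <= (3 ^+ n)%:E * \int[leb]_(x in A) f x.
  have mfA : measurable_fun setT (f \_ A).
    by apply/(measurable_restrict _ mA) => //; rewrite ?setTI; exact: measurable_funTS.
  have fA0 x : 0 <= (f \_ A) x by rewrite /patch; case: ifP.
  apply: (@le_trans _ _ ((3 ^+ n)%:E * \int[leb]_(x in E K) (f \_ A) x)).
    apply: greedy_covering => //; first by rewrite divr_ge0 // ltW.
    move=> q /mapP[k]; rewrite mem_filter => /andP[tk _] ->{q} /=; split => //.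
    have mQ : measurable (cube (a k) (l k)) by exact: measurable_cube.
    have lk : (0 < l k ^+ n)%R by rewrite exprn_gt0.
    have : (t * l k ^+ n)%:E <= \int[leb]_(x in cube (a k) (l k)) (f \_ A) x + (t / 2 * l k ^+ n)%:E.
      apply: (@le_trans _ _ (\int[leb]_(x in cube (a k) (l k)) f x)).
        by move: tk; rewrite /cube_avg lte_pdivlMl // mulrC EFinM => /ltW.
      rewrite EFinM -(@integral_cst_cube _ (a k)) //.
      rewrite -ge0_integralD //; [|exact: measurable_funTS|by move=> x _; rewrite lee_fin divr_ge0 // ltW].
      apply: ge0_le_integral => //.
      - exact: measurable_funTS.
      - by apply: emeasurable_funD => //; exact: measurable_funTS.
      move=> x _; rewrite /patch; case: ifPn => [_|].
        by rewrite leeDl // lee_fin divr_ge0 // ltW.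
      rewrite notin_setE /A /= => /negP; rewrite -leNgt add0e /cst.
      by rewrite mulrC EFinM lee_pdivlMl.
    rewrite -leeBlDr // => h; apply: le_trans h.
    by rewrite -EFinB lee_fin; lra.
  apply: lee_wpmul2l; first by rewrite lee_fin exprn_ge0.
  rewrite [leRHS]integral_mkcond.
  by apply: ge0_subset_integral.
have /cvg_lim <- // : leb \o E @ \oo --> leb (\bigcup_K E K).
  apply: nondecreasing_cvg_mu => //; first exact: bigcup_measurable.
  move=> i j ij; apply/subsetPset => x /EP[k [ki ? ?]]; apply/EP; exists k; split => //.
  exact: leq_trans ki ij.
rewrite -lee_pdivlMl ?divr_gt0 //.
apply: lime_le.
  apply: ereal_nondecreasing_is_cvgn => i j ij; apply: le_measure; rewrite ?inE //.
  move=> x /EP[k [ki ? ?]]; apply/EP; exists k; split => //; exact: leq_trans ki ij.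
by apply: nearW => K; rewrite lee_pdivlMl ?divr_gt0 //; exact: Ebound.
Qed.

End maximal.
Arguments maximal {R n}.

(** * Dyadic sums replacing integration over levels *)

Section layer_cake.
Context (R : realType).
Local Open Scope ereal_scope.

Lemma le_poweR (x y : \bar R) (r : R) : (0 <= r)%R -> 0 <= x -> x <= y ->
  x `^ r <= y `^ r.
Proof.
move=> r0 x0 xy; apply: gt0_ler_poweR => //.
- by rewrite in_itv /= x0 leey.
- by rewrite in_itv /= (le_trans x0 xy) leey.
Qed.

Lemma indic_lte (T : Type) (g : T -> \bar R) (t : \bar R) x :
  \1_[set x | t < g x] x = (t < g x)%E%:R :> R.
Proof. by rewrite indicE; congr ((nat_of_bool _)%:R); apply/idP/idP; rewrite inE. Qed.

Lemma nneseries_ge_term (u : nat -> \bar R) k : (forall i, 0 <= u i) ->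
  u k <= \sum_(i <oo) u i.
Proof.
move=> u0; apply: (le_trans _ (nneseries_lim_ge k.+1 _)) => //.
by rewrite big_mkord big_ord_recr /= leeDr // sume_ge0.
Qed.

Lemma exists_pow2_gt (e A : R) : (0 < e)%R -> exists k, (A < e * 2 ^+ k)%R.
Proof.
move=> e0; exists (Num.bound (`|A| / e)).
have h0 : (0 <= `|A| / e)%R by rewrite divr_ge0 // ltW.
have := archi_boundP h0; set N := Num.bound _ => h.
have hN : (N%:R < 2 ^+ N :> R)%R by rewrite -natrX ltr_nat ltn_expl.
apply: (le_lt_trans (ler_norm A)); rewrite mulrC -ltr_pdivrMr //.
exact: lt_trans h hN.
Qed.

(** A single term suffices when [y] is finite: the one with [e 2^k < y <= e 2^(k+1)], which exists
    because [e < y]. When [y] is infinite the terms are unbounded. The floor [e] allows summation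
    over natural [k] only. *)
Lemma dyadic_layer_cake (y : \bar R) (e p : R) : (0 < e)%R -> (1 <= p)%R ->
  e%:E < y ->
  y `^ p <= \sum_(k <oo) (((e * 2 ^+ k.+1) `^ p)%:E * ((e * 2 ^+ k)%:E < y)%E%:R%:E).
Proof.
move=> e0 p1 ey; have p0 : (0 <= p)%R by lra.
pose u k := ((e * 2 ^+ k.+1) `^ p)%:E * ((e * 2 ^+ k)%:E < y)%E%:R%:E.
change (y `^ p <= \sum_(k <oo) u k).
have u0 k : 0 <= u k.
  by rewrite /u mule_ge0 // lee_fin ?powR_ge0.
case: y ey @u u0 => [y| |//] ey u u0.
  have ex : exists k, (y <= e * 2 ^+ k)%R.
    by have [k hk] := exists_pow2_gt _ y e0; exists k; exact: ltW.
  have := ex_minnP ex => -[[|k] hk kmin].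
    by move: hk ey; rewrite expr0 mulr1 lte_fin leNgt => /negbTE ->.
  apply: le_trans (nneseries_ge_term _ k u0); rewrite /u.
  have -> : (e * 2 ^+ k)%:E < y%:E.
    by rewrite lte_fin ltNge; apply/negP => /kmin; rewrite ltnn.
  rewrite mule1 lee_fin ge0_ler_powR // nnegrE.
    by rewrite ltW // -lte_fin (lt_trans _ ey) // lte_fin.
  by rewrite mulr_ge0 ?exprn_ge0 // ltW.
suff -> : \sum_(k <oo) u k = +oo by rewrite leey.
apply/eqyP => A A0; have [k hk] := exists_pow2_gt _ (Num.max A 1)%R e0.
apply: le_trans (nneseries_ge_term _ k u0); rewrite /u ltry mule1 lee_fin.
move: hk; rewrite gt_max => /andP[hA h1].
have h2 : (e * 2 ^+ k <= e * 2 ^+ k.+1)%R.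
  by rewrite ler_pM2l // ler_eXn2l // ltr1n.
apply: (le_trans (ltW hA)); apply: (le_trans h2).
rewrite -[leLHS]powRr1; last by lra.
by rewrite ler_powR //; lra.
Qed.

(* Telescoping: with [c = 1 - 2^-s], [c (e 2^k)^s = (e 2^k)^s - (e 2^(k-1))^s] *)
Lemma dyadic_geometric_sum (y : \bar R) (e s : R) : (0 < e)%R -> (0 < s)%R -> 0 <= y ->
  \sum_(k <oo) (((e * 2 ^+ k) `^ s)%:E * ((e * 2 ^+ k)%:E < y)%E%:R%:E) <=
    ((1 - 2 `^ (- s))^-1)%:E * y `^ s.
Proof.
move=> e0 s0 y0.
have c0 : (0 < 1 - 2 `^ (- s) :> R)%R.
  rewrite subr_gt0 -[ltRHS](@powRr0 _ 2) //.
  by rewrite /powR pnatr_eq0 /= ltr_expR mul0r mulNr oppr_lt0 mulr_gt0 // ln_gt0 ?ltr1n.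
case: y y0 => [y| |//] y0; last first.
  by rewrite poweRyr ?gt_eqF // gt0_muley ?leey // lte_fin invr_gt0.
apply: lime_le; first by apply: is_cvg_nneseries => k _ _; rewrite mule_ge0 // lee_fin ?powR_ge0.
apply: nearW => K; rewrite poweR_EFin -EFinM mulrC.
under eq_bigr do rewrite -EFinM.
rewrite sumEFin lee_fin ler_pdivlMr // big_mkord.
pose al k := ((e * 2 ^+ k) `^ s)%R.
have alS k : (al k = al k.+1 * 2 `^ (- s))%R.
  rewrite /al exprSr mulrA [in RHS]powRM ?mulr_ge0 ?exprn_ge0 // ?ltW // -mulrA -powRD.
    by rewrite subrr powRr0 mulr1.
  by rewrite pnatr_eq0 implybT.
have al0 k : (0 <= al k)%R by rewrite powR_ge0.
have q0 : (0 <= 2 `^ (- s) :> R)%R by rewrite powR_ge0.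
(* The second bound is the telescoped sum. It yields the first at each level [K] below [y], where
   the new total is at most [al K <= y^s]. *)
suff: ((\sum_(k < K) (al k * ((e * 2 ^+ k)%:E < y%:E)%E%:R)) * (1 - 2 `^ (- s)) <= y `^ s /\
  (\sum_(k < K) (al k * ((e * 2 ^+ k)%:E < y%:E)%E%:R)) * (1 - 2 `^ (- s)) <= al K * 2 `^ (- s))%R by case.
elim: K => [|K [IH1 IH2]].
  by rewrite big_ord0 mul0r powR_ge0 mulr_ge0.
rewrite big_ord_recr /= lte_fin -alS; case: ltP => h; rewrite ?mulr1 ?mulr0 ?addr0.
  have hy : (al K <= y `^ s)%R.
    rewrite /al ge0_ler_powR ?nnegrE ?mulr_ge0 ?exprn_ge0 // ltW //.
  split; [apply: le_trans hy|]; rewrite mulrDl; nra.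
split => //; apply: (le_trans IH2); have := mulr_ge0 (al0 K) (ltW c0); lra.
Qed.

(** Source of the factor [1/(p-1)] in the maximal theorem, with [s = p - 1]: for [q = 2^s] the left
    side is [q / (q - 1)], where [q <= 2] and [q - 1 >= s ln 2]. *)
Lemma inv_1subr_pow2_le (s : R) : (0 < s <= 1)%R ->
  ((1 - 2 `^ (- s))^-1 <= 2 / ln 2 / s)%R.
Proof.
move=> /andP[s0 s1]; have l2 : (0 < ln 2 :> R)%R by rewrite ln_gt0 ?ltr1n.
have h1 : (1 + s * ln 2 <= 2 `^ s :> R)%R.
  by rewrite /powR pnatr_eq0 /= expR_ge1Dx.
have h2 : (2 `^ s <= 2 :> R)%R.
  by rewrite -[leRHS]powRr1 // ler_powR // ler1n.
have h3 : (0 < 2 `^ s :> R)%R by rewrite powR_gt0.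
rewrite powRN; set q := (2 `^ s)%R in h1 h2 h3 *.
have -> : ((1 - q^-1)^-1 = q / (q - 1))%R.
  have : (0 < s * ln 2)%R by rewrite mulr_gt0.
  move=> ?; field; apply/andP; split; rewrite gt_eqF //; lra.
have sl : (0 < s * ln 2)%R by rewrite mulr_gt0.
rewrite -mulrA -invfM [(ln 2 * s)%R]mulrC.
apply: ler_pM => //; first by rewrite ltW.
  by rewrite invr_ge0; lra.
rewrite lef_pV2 ?posrE //; lra.
Qed.

End layer_cake.

(** * The L^p bound for the maximal operator *)

Section maximal_Lp.
Context (R : realType) (n : nat) (a : nat -> n.-tuple R) (l : nat -> R).
Hypothesis l_gt0 : forall k, 0 < l k.
Local Notation Rn := (n.-tuple R).
Local Notation leb := (lebesgue_n R n).
Local Open Scope ereal_scope.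

Lemma measurable_lte_cst (g : Rn -> \bar R) (t : \bar R) : measurable_fun setT g ->
  measurable [set x | t < g x].
Proof. by move=> mg; rewrite -[X in measurable X]setTI; exact: emeasurable_fun_o_infty. Qed.

Lemma integral_cst_indic (c : R) (A : set Rn) : measurable A -> (0 <= c)%R ->
  \int[leb]_x (c%:E * (\1_A x)%:E) = c%:E * leb A.
Proof.
move=> mA c0; rewrite ge0_integralZl_EFin //; last first.
  by apply: measurableT_comp => //; exact: measurable_indic.
by rewrite integral_indic // setIT.
Qed.

Lemma integral_indicM (g : Rn -> \bar R) (A : set Rn) :
  \int[leb]_(x in A) g x = \int[leb]_x (g x * (\1_A x)%:E).
Proof.
rewrite integral_mkcond; apply: eq_integral => x _; rewrite /patch indicE.
by case: ifPn => _; rewrite ?mule1 ?mule0.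
Qed.

Lemma measurable_funM_indic (g : Rn -> \bar R) (A : set Rn) : measurable A ->
  measurable_fun setT g -> measurable_fun setT (fun x => g x * (\1_A x)%:E).
Proof.
move=> mA mg; apply: emeasurable_funM => //.
by apply: measurableT_comp => //; exact: measurable_indic.
Qed.

Lemma measurable_fun_poweR (g : Rn -> \bar R) (r : R) :
  measurable_fun setT g -> measurable_fun setT (fun x => g x `^ r).
Proof. by move=> mg; apply: (measurableT_comp (measurable_poweR r)). Qed.

(** [16 = 2 * 4 * 2]: the loss [t / 2] in the weak type bound, [2^p <= 4] from the dyadic levels,
    and [2^(p-1) <= 2] from the power of [2 f]. The factor [3^n] is the covering constant and
    [2 / ln 2] comes from [inv_1subr_pow2_le]. *)
Definition maximal_const : R := (16 * 3 ^+ n * (2 / ln 2))%R.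

Lemma maximal_const_ge1 : (1 <= maximal_const)%R.
Proof.
have l2 : (0 < ln 2 :> R)%R by rewrite ln_gt0 ?ltr1n.
have l2' : (ln 2 <= 1 :> R)%R.
  by have := @le_ln1Dx R 1 ltac:(lra); rewrite -natr1.
have h : (1 <= (ln 2)^-1 :> R)%R by rewrite invf_ge1.
have h3 : (1 <= 3 ^+ n :> R)%R by rewrite exprn_ege1 // ler1n.
rewrite /maximal_const; nra.
Qed.

(** Marcinkiewicz interpolation in dyadic form: layers of the maximal function, the weak type bound
    at each level, then sum and integral are exchanged and, at fixed [x], the levels below [2 f x]
    add up to a multiple of [(2 f x)^(p-1) / (p-1)]. *)
Lemma maximal_Lp_above (f : Rn -> \bar R) (p e : R) :
  (forall x, 0 <= f x) -> measurable_fun setT f -> (1 < p <= 2)%R -> (0 < e)%R ->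
  \int[leb]_(x in [set x | e%:E < maximal a l f x]) (maximal a l f x) `^ p <=
    (maximal_const / (p - 1))%:E * \int[leb]_x f x `^ p.
Proof.
move=> f0 mf /andP[p1 p2] e0.
set M := maximal a l f; have mM : measurable_fun setT M by exact: measurable_maximal.
pose t k := (e * 2 ^+ k)%R; have t0 k : (0 < t k)%R by rewrite mulr_gt0 ?exprn_gt0.
pose A k := [set x | (t k)%:E < M x]; pose B k := [set x | (t k)%:E < 2%:E * f x].
have mA k : measurable (A k) by exact: measurable_lte_cst.
have mB k : measurable (B k) by apply: measurable_lte_cst; exact: measurable_funeM.
pose s := (p - 1)%R; have s0 : (0 < s)%R by rewrite /s; lra.
have s1 : (s <= 1)%R by rewrite /s; lra.
pose K0 : R := (2 * 3 ^+ n * 2 `^ p)%R.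
have K00 : (0 <= K0)%R by rewrite !mulr_ge0 ?exprn_ge0 // powR_ge0.
have step k : (((2 * t k) `^ p)%R)%:E * leb (A k) <=
    \int[leb]_x (K0%:E * f x * (((t k) `^ s)%:E * (\1_(B k) x)%:E)).
  have -> : (((2 * t k) `^ p)%R)%:E = (K0 * t k `^ s / 3 ^+ n)%:E * (t k / 2)%:E.
    rewrite -EFinM; congr EFin.
    have -> : (p = s + 1)%R by rewrite /s; lra.
    rewrite /K0 /s powRM ?ltW // [in LHS](@powRD _ (t k)) ?(gt_eqF (t0 k)) ?implybT //.
    rewrite powRr1 ?ltW //.
    have ? : (3 ^+ n != 0 :> R)%R by rewrite expf_neq0.
    have -> : (p - 1 + 1 = p)%R by lra.
    by field.
  rewrite -muleA; apply: (@le_trans _ _ ((K0 * t k `^ s / 3 ^+ n)%:E *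
      ((3 ^+ n)%:E * \int[leb]_(x in B k) f x))).
    apply: lee_wpmul2l; first by rewrite lee_fin divr_ge0 ?exprn_ge0 // mulr_ge0 ?powR_ge0.
    exact: maximal_weak_type.
  rewrite muleA -EFinM divfK ?expf_neq0 //.
  rewrite integral_indicM -ge0_integralZl_EFin //.
  - apply: ge0_le_integral => //.
    + by move=> x _; rewrite mule_ge0 ?lee_fin ?mulr_ge0 ?powR_ge0 // mule_ge0 // lee_fin.
    + by apply: measurable_funeM; exact: measurable_funM_indic.
    + apply: emeasurable_funM; first exact: measurable_funeM.
      apply: measurable_funeM; apply: measurableT_comp => //; exact: measurable_indic.
    + by move=> x _; rewrite EFinM -!muleA lee_wpmul2l ?lee_fin // muleCA.
  - by move=> x _; rewrite mule_ge0 // lee_fin.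
  - exact: measurable_funM_indic.
  - by rewrite mulr_ge0 ?powR_ge0.
have -> : [set x | e%:E < M x] = A 0%N by rewrite /A /t expr0 mulr1.
rewrite integral_indicM.
apply: (@le_trans _ _ (\int[leb]_x \sum_(k <oo) ((((2 * t k) `^ p)%R)%:E * (\1_(A k) x)%:E))).
  apply: ge0_le_integral => //.
  - by move=> x _; rewrite mule_ge0 ?poweR_ge0 // lee_fin.
  - by apply: measurable_funM_indic => //; exact: measurable_fun_poweR.
  - apply: ge0_emeasurable_sum => k; first by move=> x _ _; rewrite mule_ge0 ?lee_fin ?powR_ge0.
    by move=> _; apply: measurable_funeM; apply: measurableT_comp => //; exact: measurable_indic.
  - move=> x _; rewrite indic_lte; case: (boolP ((t 0)%:E < M x)) => h; last first.
      by rewrite mule0; apply: nneseries_ge0 => k _ _; rewrite mule_ge0 ?lee_fin ?powR_ge0.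
    rewrite mule1; move: h; rewrite /t expr0 mulr1 => h.
    have := dyadic_layer_cake _ (M x) e p e0 (ltW p1) h.
    congr (_ <= _); apply: eq_eseriesr => k _; rewrite indic_lte; congr (_%:E * _).
    by rewrite exprS mulrCA.
rewrite integral_nneseries //; last 2 first.
  - by move=> k; apply: measurable_funeM; apply: measurableT_comp => //; exact: measurable_indic.
  - by move=> k x _; rewrite mule_ge0 ?lee_fin ?powR_ge0.
have g0 k x : 0 <= K0%:E * f x * (((t k) `^ s)%:E * (\1_(B k) x)%:E).
  by rewrite mule_ge0 ?lee_fin ?mulr_ge0 ?powR_ge0 // mule_ge0 // lee_fin.
have mg k : measurable_fun setT (fun x => K0%:E * f x * (((t k) `^ s)%:E * (\1_(B k) x)%:E)).
  apply: emeasurable_funM; first exact: measurable_funeM.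
  by apply: measurable_funeM; apply: measurableT_comp => //; exact: measurable_indic.
apply: (@le_trans _ _ (\sum_(k <oo) \int[leb]_x (K0%:E * f x * (((t k) `^ s)%:E * (\1_(B k) x)%:E)))).
  apply: lee_nneseries.
    by move=> k _ _; apply: integral_ge0 => x _; rewrite mule_ge0 ?lee_fin ?powR_ge0.
  by move=> k _; rewrite integral_cst_indic ?powR_ge0.
rewrite -integral_nneseries //.
have mfp : measurable_fun setT (fun x => f x `^ p) by exact: measurable_fun_poweR.
have c0 : (0 <= maximal_const / (p - 1))%R.
  by rewrite divr_ge0 ?(le_trans _ maximal_const_ge1) // ltW.
rewrite -ge0_integralZl_EFin //; last by move=> x _; rewrite poweR_ge0.
apply: ge0_le_integral => //.
- by move=> x _; apply: nneseries_ge0.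
- by apply: ge0_emeasurable_sum.
- exact: measurable_funeM.
move=> x _.
have [fy|fy] := eqVneq (f x) +oo.
  rewrite fy poweRyr; last by rewrite gt_eqF //; lra.
  rewrite [leRHS]gt0_muley ?leey // lte_fin divr_gt0 // (lt_le_trans _ maximal_const_ge1) //.
have ffin : f x \is a fin_num by rewrite ge0_fin_numE // lt_neqAle fy leey.
have -> : \sum_(k <oo) (K0%:E * f x * (((t k) `^ s)%:E * (\1_(B k) x)%:E)) =
   K0%:E * f x * \sum_(k <oo) (((t k) `^ s)%:E * ((t k)%:E < 2%:E * f x)%E%:R%:E).
  rewrite -(fineK ffin) -EFinM -nneseriesZl; last first.
    by move=> k _; rewrite mule_ge0 // lee_fin ?powR_ge0.
  by apply: eq_eseriesr => k _; rewrite indic_lte (fineK ffin).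
apply: (@le_trans _ _ (K0%:E * f x * (((1 - 2 `^ (- s))^-1)%:E * (2%:E * f x) `^ s))).
  apply: lee_wpmul2l; first by rewrite mule_ge0 // lee_fin.
  by apply: dyadic_geometric_sum => //; rewrite mule_ge0 // lee_fin.
have := inv_1subr_pow2_le _ s; rewrite s0 s1 => /(_ isT) hc.
have := f0 x; rewrite -(fineK ffin); set y := fine (f x); rewrite lee_fin => y0.
rewrite -[2%:E * y%:E]EFinM !poweR_EFin -!EFinM lee_fin.
have hp : (y `^ p = y * y `^ s)%R.
  have -> : (p = 1 + s)%R by rewrite /s; lra.
  have [->|yn0] := eqVneq y 0%R; first by rewrite mul0r powR0 //; rewrite gt_eqF //; lra.
  by rewrite powRD ?(negbTE yn0) ?implybT // powRr1.
rewrite hp powRM //.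
have h2p : (2 `^ p <= 4 :> R)%R.
  have -> : (4 = 2 `^ 2%:R :> R)%R by rewrite powR_mulrn // expr2; lra.
  by rewrite ler_powR // ler1n.
have h2s : (2 `^ s <= 2 :> R)%R by rewrite -[leRHS]powRr1 // ler_powR // ler1n.
have c'0 : (0 <= (1 - 2 `^ (- s))^-1)%R.
  rewrite invr_ge0 subr_ge0 -[leRHS](@powRr0 _ 2) // ler_powR ?ler1n //; lra.
rewrite /maximal_const -/s.
have -> : (K0 * y * ((1 - 2 `^ (- s))^-1 * (2 `^ s * y `^ s)) =
  (2 * 3 ^+ n * (2 `^ p * 2 `^ s)) * (1 - 2 `^ (- s))^-1 * (y * y `^ s))%R.
  by rewrite /K0; ring.
apply: ler_wpM2r; first by rewrite mulr_ge0 // powR_ge0.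
rewrite -[leRHS]mulrA; apply: ler_pM => //.
have -> : (16 * 3 ^+ n = 2 * 3 ^+ n * (4 * 2) :> R)%R by ring.
apply: ler_wpM2l; first by rewrite mulr_ge0 ?exprn_ge0.
by apply: ler_pM => //; rewrite powR_ge0.
Qed.

(** Monotone convergence along the floors [1/(i+1)]; outside the union of the sets [E i] the maximal
    function vanishes. *)
Lemma maximal_Lp (f : Rn -> \bar R) (p : R) :
  (forall x, 0 <= f x) -> measurable_fun setT f -> (1 < p <= 2)%R ->
  \int[leb]_x (maximal a l f x) `^ p <=
    (maximal_const / (p - 1))%:E * \int[leb]_x f x `^ p.
Proof.
move=> f0 mf p12; have /andP[p1 p2] := p12.
pose M := maximal a l f; have mM : measurable_fun setT M by exact: measurable_maximal.
have M0 x : 0 <= M x by exact: maximal_ge0.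
pose E i := [set x | (i.+1%:R^-1)%:E < M x].
have mE i : measurable (E i) by exact: measurable_lte_cst.
have ndE : {homo E : i j / (i <= j)%N >-> (i <= j)%O}.
  move=> i j ij; apply/subsetPset => x /=; apply: le_lt_trans.
  by rewrite lee_fin lef_pV2 ?posrE // ler_nat.
have mMp : measurable_fun setT (fun x => M x `^ p) by exact: measurable_fun_poweR.
have := @ge0_nondecreasing_set_cvg_integral _ _ _ E (fun x => M x `^ p) leb ndE mE
  (fun i => measurable_funTS mMp) (fun i x _ => poweR_ge0 _ _).
have -> : \int[leb]_(x in \bigcup_i E i) M x `^ p = \int[leb]_x M x `^ p.
  rewrite integral_mkcond; apply: eq_integral => x _; rewrite /patch; case: ifPn => //.
  rewrite notin_setE => hx; have -> : M x = 0; last by rewrite poweR0r // gt_eqF //; lra.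
  apply/eqP; rewrite eq_le M0 andbT leNgt; apply/negP => Mx; apply: hx.
  case Mxr: (M x) Mx => [r| |//] r0.
    exists (Num.bound r^-1) => //; rewrite /E /= Mxr lte_fin.
    rewrite invf_plt ?posrE //.
    have h : (0 <= r^-1)%R by rewrite invr_ge0 ltW.
    by apply: (lt_le_trans (archi_boundP h)); rewrite ler_nat.
  by exists 0%N => //; rewrite /E /= Mxr ltry.
move=> cv; rewrite -(cvg_lim _ cv) //; apply: lime_le; first by apply/cvg_ex; exists (\int[leb]_x M x `^ p).
by apply: nearW => i; apply: maximal_Lp_above => //; rewrite invr_gt0.
Qed.

End maximal_Lp.

(** * Rubio de Francia's iteration *)

Section rubio_de_francia.
Context (R : realType).
Local Open Scope ereal_scope.

Lemma nneseries_half (z : \bar R) : 0 <= z ->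
  \sum_(k <oo) ((2 ^- k.+1)%:E * z) = z.
Proof.
case: z => [r| |//] r0; last first.
  apply/eqP; rewrite eq_le leey /=.
  apply: le_trans (nneseries_ge_term _ (fun k => (2 ^- k.+1)%:E * +oo) 0 _).
    by rewrite gt0_muley // lte_fin invr_gt0 exprn_gt0.
  by move=> k; rewrite mule_ge0 // lee_fin invr_ge0 exprn_ge0.
have := @cvg_geometric_eseries_half R r 0; rewrite expr0 divr1 => /cvg_lim hr.
rewrite -[RHS]hr //.
apply: congr_lim; apply/funext => N; rewrite /eseries /=; apply: eq_bigr => k _.
by rewrite -EFinM addn1 natrX mulrC.
Qed.

Lemma rubio_de_francia (n : nat) : exists2 D : R, (1 <= D)%R &
  forall p : R, (1 < p <= 2)%R -> forall F : n.-tuple R -> \bar R,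
  (forall x, 0 <= F x) -> measurable_fun setT F ->
  exists G : n.-tuple R -> \bar R,
  [/\ measurable_fun setT G, forall x, F x <= G x,
      \int[lebesgue_n R n]_x G x `^ p <= 8%:E * \int[lebesgue_n R n]_x F x `^ p,
      forall b m x, (0 < m)%R -> cube b m x -> cube_avg G b m <= (D / (p - 1))%:E * G x &
      forall K : R, (forall x, F x <= K%:E) -> forall x, G x <= (2 * K)%:E].
Proof.
have [a [l [l0 al]]] := countable_cubes R n.
pose C : R := maximal_const R n; have C1 : (1 <= C)%R := maximal_const_ge1 R n.
(* [2^n] is the loss from the countable family of cubes, and [4 C / (p-1)] is the inverse of the
   ratio [c] below. *)
exists (2 ^+ n * 4 * C)%R.
  have : (1 <= 2 ^+ n :> R)%R by rewrite exprn_ege1 // ler1n.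
  nra.
move=> p p12 F F0 mF; have /andP[p1 p2] := p12.
pose B := (C / (p - 1))%R.
have B1 : (1 <= B)%R by rewrite /B ler_pdivlMr; lra.
(* [4 B = 2 * (2 B)]: one factor 2 supplies the averaging weights, and [2 B] makes the integrals of
   the [(y k)^p] decay like [2^-k]. The bound 8 is [4 * 2], from [2^p <= 4] and the sum of the
   [2^-k]. *)
pose c := (4 * B)^-1%R.
have c0 : (0 < c)%R by rewrite invr_gt0; lra.
pose M := maximal a l.
have H k : (forall x, 0 <= iter k M F x) /\ measurable_fun setT (iter k M F).
  case: k => [|k] //=; split; last exact: measurable_maximal.
  elim: k => [|k IH] x; apply: maximal_ge0 => //.
pose u k x := (c ^+ k)%:E * iter k M F x.
have u0 k x : 0 <= u k x.
  by apply: mule_ge0; [rewrite lee_fin exprn_ge0 // ltW|exact: (H k).1].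
have mu k : measurable_fun setT (u k) by apply: measurable_funeM; exact: (H k).2.
pose G x := \sum_(k <oo) u k x.
have mG : measurable_fun setT G by exact: ge0_emeasurable_sum.
have G0 x : 0 <= G x by exact: nneseries_ge0.
exists G; split => //.
- move=> x; apply: le_trans (nneseries_ge_term _ (u ^~ x) 0%N (u0 ^~ x)).
  by rewrite /u /= expr0 mul1e.
- (* [G] is the average of the [y k] with weights [2^-(k+1)], hence at most their
     supremum, and [G^p] is at most the sum of the [(y k)^p]. *)
  pose y k x := (2 * (2 * B) ^- k)%:E * iter k M F x.
  have k0 k : (0 <= 2 * (2 * B) ^- k)%R by rewrite mulr_ge0 // invr_ge0 exprn_ge0 //; lra.
  have y0 k x : 0 <= y k x by apply: mule_ge0; [rewrite lee_fin|exact: (H k).1].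
  have my k : measurable_fun setT (y k) by apply: measurable_funeM; exact: (H k).2.
  have p0 : (p != 0)%R by rewrite gt_eqF //; lra.
  have GS x : G x `^ p <= \sum_(k <oo) y k x `^ p.
    set S := \sum_(k <oo) _.
    have S0 : 0 <= S by apply: nneseries_ge0 => k _ _; exact: poweR_ge0.
    have yS k : y k x <= S `^ p^-1.
      rewrite -[leLHS]poweRe1 // -(mulfV p0) poweRrM le_poweR ?poweR_ge0 //.
        by rewrite invr_ge0; lra.
      by apply: (nneseries_ge_term _ (fun k => y k x `^ p) k) => i; exact: poweR_ge0.
    have GS : G x <= S `^ p^-1.
      rewrite -[leRHS]nneseries_half ?poweR_ge0 //; apply: lee_nneseries => // k _.
      have -> : u k x = (2 ^- k.+1)%:E * y k x.
        rewrite /u /y muleA -EFinM; congr (_%:E * _).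
        rewrite /c exprVn (_ : 4 * B = 2 * (2 * B))%R; last by ring.
        have X0 : ((2 * B) ^+ k != 0)%R by rewrite expf_neq0 // gt_eqF //; lra.
        have Y0 : (2 ^+ k != 0 :> R)%R by rewrite expf_neq0.
        rewrite [in LHS]exprMn exprS; move: X0 Y0.
        by move: ((2 * B) ^+ k)%R (2 ^+ k)%R => X Y X0 Y0; field; apply/andP.
      by apply: lee_wpmul2l => //; rewrite lee_fin invr_ge0 exprn_ge0.
    have := le_poweR _ _ _ p _ (G0 x) GS; rewrite -poweRrM mulVf // poweRe1 //.
    by apply; lra.
  apply: (@le_trans _ _ (\int[lebesgue_n R n]_x \sum_(k <oo) y k x `^ p)).
    apply: ge0_le_integral => //.
    - by move=> x _; exact: poweR_ge0.
    - exact: measurable_fun_poweR.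
    - apply: ge0_emeasurable_sum => k; first by move=> *; exact: poweR_ge0.
      by move=> _; exact: measurable_fun_poweR.
  rewrite integral_nneseries //; last 2 first.
  - by move=> k; exact: measurable_fun_poweR.
  - by move=> k x _; exact: poweR_ge0.
  set I := \int[_]_x F x `^ p; have I0 : 0 <= I by apply: integral_ge0 => x _; exact: poweR_ge0.
  have HI k : \int[lebesgue_n R n]_x (iter k M F x) `^ p <= (B ^+ k)%:E * I.
    elim: k => [|k IH]; first by rewrite expr0 mul1e.
    have [h1 h2] := H k.
    apply: (le_trans (maximal_Lp _ _ _ _ l0 _ _ h1 h2 p12)).
    rewrite -/C -/B exprS (EFinM B) -muleA; apply: lee_wpmul2l => //.
    by rewrite lee_fin; lra.
  rewrite -[leRHS]nneseries_half; last by rewrite mule_ge0.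
  apply: lee_nneseries => [k _ _|k _]; first by apply: integral_ge0 => x _; exact: poweR_ge0.
  have [h1 h2] := H k.
  have -> : \int[lebesgue_n R n]_x y k x `^ p =
     ((2 * (2 * B) ^- k) `^ p)%:E * \int[lebesgue_n R n]_x (iter k M F x) `^ p.
    rewrite -ge0_integralZl_EFin ?powR_ge0 //.
    - by apply: eq_integral => x _; rewrite /y poweRM ?lee_fin.
    - by move=> x _; exact: poweR_ge0.
    - exact: measurable_fun_poweR.
  apply: (@le_trans _ _ ((((2 * (2 * B) ^- k) `^ p)%R)%:E * ((B ^+ k)%:E * I))).
    by apply: lee_wpmul2l => //; rewrite lee_fin powR_ge0.
  rewrite !muleA; apply: lee_wpmul2r => //; rewrite -!EFinM lee_fin.
  rewrite powRM ?invr_ge0 ?exprn_ge0 //; last by lra.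
  have h2p : (2 `^ p <= 4 :> R)%R.
    have -> : (4 = 2 `^ 2%:R :> R)%R by rewrite powR_mulrn // expr2; lra.
    by rewrite ler_powR // ler1n.
  have hq : (((2 * B) ^- k) `^ p <= (2 * B) ^- k)%R.
    have X1 : (1 <= (2 * B) ^+ k)%R by rewrite exprn_ege1 //; lra.
    by apply: ge1r_powR (ltW p1); rewrite invr_gt0 invf_le1 (lt_le_trans _ X1).
  have -> : (2 ^- k.+1 * 8 = 4 * (2 * B) ^- k * B ^+ k :> R)%R.
    have ? : (2 ^+ k != 0 :> R)%R by rewrite expf_neq0.
    have ? : (B ^+ k != 0 :> R)%R by rewrite expf_neq0 // gt_eqF //; lra.
    by rewrite exprMn exprS; field; apply/andP.
  apply: ler_wpM2r; first by rewrite exprn_ge0 //; lra.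
  by apply: ler_pM => //; rewrite powR_ge0.
- move=> b m x m0 bx.
  have -> : cube_avg G b m = \sum_(k <oo) cube_avg (u k) b m.
    rewrite /cube_avg integral_nneseries //; [|exact: measurable_cube|by move=> k; exact: measurable_funTS].
    rewrite -nneseriesZl // => k _; exact: integral_ge0.
  (* The maximal operator shifts the series: an average of [u k] is at most [2^n / c] times the next
     term, so the sum is controlled by [G] without its term of index 0. *)
  have cu k : cube_avg (u k) b m <= (2 ^+ n * (4 * B))%:E * u k.+1 x.
    have [h1 h2] := H k.
    have -> : cube_avg (u k) b m = (c ^+ k)%:E * cube_avg (iter k M F) b m.
      rewrite /cube_avg ge0_integralZl_EFin //; first by rewrite muleCA.
      - exact: measurable_cube.
      - exact: measurable_funTS.
      - by rewrite exprn_ge0 // ltW.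
    have -> : (2 ^+ n * (4 * B))%:E * u k.+1 x =
        (c ^+ k)%:E * ((2 ^+ n)%:E * maximal a l (iter k M F) x).
      rewrite /u !muleA -!EFinM exprS; congr (_%:E * _).
      by rewrite /c; field; lra.
    apply: lee_wpmul2l; first by rewrite lee_fin exprn_ge0 // ltW.
    by apply: cube_avg_le_maximal => //; exact: al.
  have -> : (2 ^+ n * 4 * C / (p - 1) = 2 ^+ n * (4 * B))%R by rewrite /B; ring.
  have d0 : (0 <= 2 ^+ n * (4 * B))%R by rewrite mulr_ge0 ?exprn_ge0 //; lra.
  apply: (@le_trans _ _ (\sum_(k <oo) ((2 ^+ n * (4 * B))%:E * u k.+1 x))).
    by apply: lee_nneseries => // k _ _; exact: cube_avg_ge0.
  rewrite nneseriesZl //; apply: lee_wpmul2l; first by rewrite lee_fin.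
  apply: lime_le; first by apply: is_cvg_nneseries.
  apply: nearW => N; apply: (le_trans _ (nneseries_lim_ge N.+1 _)) => //.
  by rewrite !big_mkord big_ord_recl leeDr.
- move=> K FK x.
  have K0 : (0 <= K)%R by rewrite -lee_fin; apply: le_trans (FK x).
  have HK k : forall x, iter k M F x <= K%:E.
    by elim: k => [//|k IH] z; have [h1 h2] := H k; apply: maximal_le_cst.
  rewrite -[leRHS]nneseries_half ?lee_fin ?mulr_ge0 //.
  apply: lee_nneseries => // k _; rewrite /u.
  apply: (@le_trans _ _ ((c ^+ k)%:E * K%:E)).
    by apply: lee_wpmul2l; rewrite // lee_fin exprn_ge0 // ltW.
  rewrite -!EFinM lee_fin mulrA; apply: ler_wpM2r => //.
  rewrite exprS invfM -mulrA mulrCA mulVf // mulr1 -exprVn.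
  have c0w := ltW c0; apply: lerXn2r; rewrite ?nnegrE //.
  by rewrite /c lef_pV2 ?posrE //; lra.
Qed.

End rubio_de_francia.

(** * Muckenhoupt weights *)

Section weights.
Context (R : realType) (n : nat).
Local Notation Rn := (n.-tuple R).
Local Notation leb := (lebesgue_n R n).
Local Open Scope ereal_scope.

Lemma cube_avgZ (f : Rn -> \bar R) (k : R) b m : (0 <= k)%R ->
  (forall x, 0 <= f x) -> measurable_fun setT f ->
  cube_avg (fun x => k%:E * f x) b m = k%:E * cube_avg f b m.
Proof.
move=> k0 f0 mf; rewrite /cube_avg ge0_integralZl_EFin //; first by rewrite muleCA.
- exact: measurable_cube.
- exact: measurable_funTS.
Qed.

Lemma cube_avgD (f g : Rn -> \bar R) b m : (0 < m)%R ->
  (forall x, 0 <= f x) -> measurable_fun setT f ->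
  (forall x, 0 <= g x) -> measurable_fun setT g ->
  cube_avg (fun x => f x + g x) b m = cube_avg f b m + cube_avg g b m.
Proof.
move=> m0 f0 mf g0 mg; rewrite /cube_avg ge0_integralD //.
- by rewrite ge0_muleDr //; exact: integral_ge0.
- exact: measurable_cube.
- exact: measurable_funTS.
- exact: measurable_funTS.
Qed.

Lemma integral_cube_avg (f : Rn -> \bar R) b m : (0 < m)%R ->
  \int[leb]_(x in cube b m) f x = (m ^+ n)%:E * cube_avg f b m.
Proof.
by move=> m0; rewrite /cube_avg muleA -EFinM mulfV ?mul1e // expf_neq0 // gt_eqF.
Qed.

Lemma powR_le_neg (x y r : R) : (0 <= r -> 0 < x -> x <= y -> y `^ (- r) <= x `^ (- r))%R.
Proof.
move=> r0 x0 xy; rewrite !powRN lef_pV2 ?posrE ?powR_gt0 //; last exact: lt_le_trans xy.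
by rewrite ge0_ler_powR // nnegrE ltW // (lt_le_trans x0).
Qed.

Lemma powR_divN (x y r : R) : (0 < x -> 0 < y -> (x / y) `^ (- r) = y `^ r * x `^ (- r))%R.
Proof.
move=> x0 y0; rewrite powRM ?invr_ge0 ?ltW // mulrC; congr (_ * _)%R.
by rewrite -powR_inv1 ?ltW // -powRrM mulrN mulN1r opprK.
Qed.

(* Where [G] is [+oo] the weight [w] is [0] (as [fine +oo = 0] and [0 `^ (- r) = 0]),
   so that [dual_weight] is [+oo], as is [G `^ (r / (p0 - 1))]: no exceptional null
   set arises. *)
Lemma Ap_neg_power (G : Rn -> \bar R) (p0 r A : R) :
  measurable_fun setT G -> (1 < p0)%R -> (0 < r < p0 - 1)%R -> (1 <= A)%R ->
  (forall b m, (0 < m)%R -> cube_avg G b m < +oo) ->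
  (forall b m, (0 < m)%R -> exists2 d : R, (0 < d)%R & forall x, cube b m x -> d%:E <= G x) ->
  (forall b m x, (0 < m)%R -> cube b m x -> cube_avg G b m <= A%:E * G x) ->
  let w := fun x => (fine (G x) `^ (- r))%R in
  is_weight w /\ Ap_char p0 w <= ((2 * A) `^ (p0 - 1))%:E.
Proof.
move=> mG p01 /andP[r0 r1] A1 Gfin Gpos GA w.
have G0 x : 0 < G x.
  have [d d0 dG] := Gpos x 1%R ltr01.
  have xx : cube x 1 x by move=> i; rewrite lexx lerDl ler01.
  by apply: lt_le_trans (dG x xx); rewrite lte_fin.
have mw : measurable_fun setT w.
  apply: (measurableT_comp (measurable_powR _)).
  exact: measurableT_comp.
have muP b m : (0 < m)%R -> exists2 mu : R, (0 < mu)%R & cube_avg G b m = mu%:E.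
  move=> m0; have [d d0 dG] := Gpos b m m0.
  have h : d%:E <= cube_avg G b m.
    rewrite -[leLHS](@cube_avg_cst _ _ _ b m) //; apply: cube_avg_le => //.
    by move=> x; rewrite lee_fin ltW.
  have := Gfin b m m0; case: (cube_avg G b m) h => [v| |] //.
  by rewrite lee_fin => dv _; exists v => //; exact: lt_le_trans dv.
have wle b m mu x : (0 < m)%R -> (0 < mu)%R -> cube_avg G b m = mu%:E -> cube b m x ->
    (w x <= A `^ r * mu `^ (- r))%R.
  move=> m0 mu0 Emu bx; rewrite -powR_divN //; last by lra.
  have := GA b m x m0 bx; rewrite Emu /w; case: (G x) (G0 x) => [g| |] //=.
    rewrite lte_fin -EFinM lee_fin => g0 h; apply: powR_le_neg; [lra|rewrite divr_gt0 //; lra|].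
    by rewrite ler_pdivrMr ?(mulrC g) //; lra.
  by move=> _ _; rewrite powR0 ?powR_ge0 // oppr_eq0 gt_eqF.
have mEw : measurable_fun setT (EFin \o w) by exact: measurableT_comp.
have avgw b m mu : (0 < m)%R -> (0 < mu)%R -> cube_avg G b m = mu%:E ->
    cube_avg (EFin \o w) b m <= (A `^ r * mu `^ (- r))%:E.
  move=> m0 mu0 Emu; rewrite -[leRHS](@cube_avg_cst _ _ _ b m) //.
  apply: cube_avg_le => //.
  - by move=> x; rewrite /= lee_fin powR_ge0.
  - by move=> x bx; rewrite /= lee_fin; exact: (wle b m).
split.
  split; first by move=> x; exact: powR_ge0.
  split => // b m m0; have [mu mu0 Emu] := muP b m m0.
  rewrite integral_cube_avg //; apply: (@le_lt_trans _ _ ((m ^+ n)%:E * (A `^ r * mu `^ (- r))%:E)).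
    by apply: lee_wpmul2l; [rewrite lee_fin exprn_ge0 // ltW|exact: avgw].
  by rewrite -EFinM ltry.
apply: ge_ereal_sup => _ [b _ [m /= m0 <-]].
have [mu mu0 Emu] := muP b m m0.
(* The dual weight of [G^-r] is [G^t], and [t <= 1] lets the averages of [G] control it. *)
pose t := (r / (p0 - 1))%R.
have t0 : (0 < t)%R by rewrite divr_gt0 //; lra.
have t1 : (t <= 1)%R by rewrite ler_pdivrMr; lra.
have dualE x : dual_weight p0 w x = G x `^ t.
  rewrite /dual_weight /w; case: (G x) (G0 x) => [g| |] //= g0.
    rewrite lte_fin in g0; rewrite gt_eqF ?powR_gt0 //; congr EFin.
    by rewrite -powRrM /t mulrNN.
  by rewrite powR0 ?oppr_eq0 ?(gt_eqF r0) // eqxx gt_eqF.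
have -> : cube_avg (dual_weight p0 w) b m = cube_avg (fun x => G x `^ t) b m.
  by congr cube_avg; apply/funext.
(* Jensen's inequality up to a factor 2, from [(g / mu)^t <= 1 + g / mu]. *)
have avgd : cube_avg (fun x => G x `^ t) b m <= (2 * mu `^ t)%:E.
  apply: (@le_trans _ _ (cube_avg (fun x => (mu `^ t)%:E * (1 + (mu^-1)%:E * G x)) b m)).
    apply: cube_avg_le => //.
    - by move=> x; exact: poweR_ge0.
    - exact: measurable_fun_poweR.
    - apply: measurable_funeM; apply: emeasurable_funD => //; exact: measurable_funeM.
    - move=> x _; case: (G x) (G0 x) => [g| |] //.
        rewrite lte_fin => g0.
        change ((g `^ t)%:E <= (mu `^ t * (1 + mu^-1 * g))%:E); rewrite lee_fin.
        have h : (0 < mu^-1 * g)%R by rewrite mulr_gt0 ?invr_gt0.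
        have -> : (g `^ t = mu `^ t * (mu^-1 * g) `^ t)%R.
          rewrite -powRM; [|exact: ltW..].
          by rewrite mulrA mulfV ?mul1r // gt_eqF.
        apply: ler_wpM2l; first exact: powR_ge0.
        case: (leP (mu^-1 * g)%R 1%R) => h1.
          have : ((mu^-1 * g) `^ t <= 1)%R.
            by have := @ge0_ler_powR R t (ltW t0) (mu^-1 * g)%R 1%R; rewrite powR1 !nnegrE (ltW h) ler01; exact.
          lra.
        by have := ler1_powR (ltW h1) t1; lra.
      move=> _; rewrite poweRyr ?gt_eqF //.
      rewrite gt0_muley ?lte_fin ?invr_gt0 // addey // gt0_muley // lte_fin powR_gt0 //.
  rewrite cube_avgZ ?powR_ge0 //.
  - rewrite cube_avgD //.
    + have -> : cube_avg (fun=> 1) b m = 1 by exact: cube_avg_cst.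
      rewrite cube_avgZ ?Emu; [|by rewrite invr_ge0 ltW|by move=> x; exact: ltW|by []].
      change ((mu `^ t * (1 + mu^-1 * mu))%:E <= (2 * mu `^ t)%:E).
      by rewrite mulVf ?gt_eqF // lee_fin mulrC.
    + by move=> x; rewrite mule_ge0 ?lee_fin ?invr_ge0 ?ltW.
    + exact: measurable_funeM.
  - move=> x; rewrite adde_ge0 // mule_ge0 ?lee_fin ?invr_ge0 ?(ltW mu0) //; exact: ltW.
  - apply: emeasurable_funD => //; exact: measurable_funeM.
have avgd0 : 0 <= cube_avg (fun x => G x `^ t) b m.
  by apply: cube_avg_ge0 => // x; exact: poweR_ge0.
(* The powers of [mu] cancel, and [A^r <= A^(p0-1)] removes the dependence on [r]. *)
apply: (@le_trans _ _ ((A `^ r * mu `^ (- r))%:E * (2 * mu `^ t)%:E `^ (p0 - 1))).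
  apply: lee_pmul.
  - by apply: cube_avg_ge0 => // x; rewrite lee_fin powR_ge0.
  - exact: poweR_ge0.
  - exact: avgw.
  - by apply: le_poweR => //; lra.
rewrite poweR_EFin -EFinM lee_fin powRM ?powR_ge0 //.
have -> : ((mu `^ t) `^ (p0 - 1) = mu `^ r)%R.
  by rewrite -powRrM /t divfK // gt_eqF //; lra.
have -> : (A `^ r * mu `^ (- r) * (2 `^ (p0 - 1) * mu `^ r) = 2 `^ (p0 - 1) * A `^ r)%R.
  have : (mu `^ (- r) * mu `^ r = 1)%R by rewrite powRN mulVf // gt_eqF // powR_gt0.
  by move=> h; rewrite mulrCA -!mulrA h mulr1.
rewrite powRM //; last by lra.
by apply: ler_wpM2l; [exact: powR_ge0|rewrite ler_powR //; lra].
Qed.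

(** On a cube where [w] has mean [mu] the A_1 condition reads [w >= mu / A], so the dual factor is
    at most [A / mu]. The bound is linear in [A] for every [p0]. *)
Lemma Ap_of_A1 (w : Rn -> R) (p0 A : R) :
  measurable_fun setT w -> (1 < p0)%R -> (1 <= A)%R ->
  (forall b m, (0 < m)%R -> exists2 d : R, (0 < d)%R & forall x, cube b m x -> (d <= w x)%R) ->
  (forall b m x, (0 < m)%R -> cube b m x -> cube_avg (EFin \o w) b m <= (A * w x)%:E) ->
  is_weight w /\ Ap_char p0 w <= A%:E.
Proof.
move=> mw p01 A1 wpos wA.
have selfcube (b : Rn) m : (0 < m)%R -> cube b m b.
  by move=> m0 i; rewrite lexx lerDl ltW.
have w0 x : (0 < w x)%R.
  have [d d0 dw] := wpos x 1%R ltr01.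
  by apply: (lt_le_trans d0 (dw x _)); exact: selfcube.
have mEw : measurable_fun setT (EFin \o w) by exact: measurableT_comp.
have Ew0 x : 0 <= (EFin \o w) x by rewrite lee_fin ltW.
have muP b m : (0 < m)%R -> exists2 mu : R, (0 < mu)%R & cube_avg (EFin \o w) b m = mu%:E.
  move=> m0; have [d d0 dG] := wpos b m m0.
  have h : d%:E <= cube_avg (EFin \o w) b m.
    rewrite -[leLHS](@cube_avg_cst _ _ _ b m) //; apply: cube_avg_le => //.
    by move=> x; rewrite lee_fin ltW.
  have := wA b m b m0 (selfcube b m m0).
  case: (cube_avg _ b m) h => [v| |] //.
  by rewrite lee_fin => dv _; exists v => //; exact: lt_le_trans dv.
split.
  split; first by move=> x; exact: ltW.
  split => // b m m0; have [mu mu0 Emu] := muP b m m0.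
  by rewrite integral_cube_avg // Emu -EFinM ltry.
apply: ge_ereal_sup => _ [b _ [m /= m0 <-]].
have [mu mu0 Emu] := muP b m m0.
pose t := ((p0 - 1)^-1)%R; have t0 : (0 < t)%R by rewrite invr_gt0; lra.
have dualE x : dual_weight p0 w x = (w x `^ (- t))%:E.
  by rewrite /dual_weight gt_eqF.
have -> : cube_avg (dual_weight p0 w) b m = cube_avg (fun x => (w x `^ (- t))%:E) b m.
  by congr cube_avg; apply/funext.
have avgd : cube_avg (fun x => (w x `^ (- t))%:E) b m <= ((mu / A) `^ (- t))%:E.
  rewrite -[leRHS](@cube_avg_cst _ _ _ b m) //; apply: cube_avg_le => //.
  - by move=> x; rewrite lee_fin powR_ge0.
  - by apply: measurableT_comp => //; exact: (measurableT_comp (measurable_powR _)).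
  - move=> x bx; rewrite lee_fin; apply: powR_le_neg; [exact: ltW|rewrite divr_gt0 //; lra|].
    have := wA b m x m0 bx; rewrite Emu lee_fin => h.
    by rewrite ler_pdivrMr ?(mulrC (w x)) //; lra.
rewrite Emu.
apply: (@le_trans _ _ (mu%:E * ((mu / A) `^ (- t))%:E `^ (p0 - 1))).
  apply: lee_wpmul2l; first by rewrite lee_fin ltW.
  apply: le_poweR => //; first by lra.
  by apply: cube_avg_ge0 => // x; rewrite lee_fin powR_ge0.
rewrite poweR_EFin -EFinM lee_fin -powRrM.
have -> : (- t * (p0 - 1) = - 1)%R by rewrite mulNr mulVf // gt_eqF //; lra.
rewrite powR_inv1; last by rewrite divr_ge0 ?ltW //; lra.
by rewrite invf_div mulrCA mulfV ?mulr1 // gt_eqF.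
Qed.

Lemma weak_bound_iff (X : \bar R) (lam N q : R) : 0 <= X -> (0 < lam)%R -> (0 <= N)%R ->
  (0 < q)%R -> (lam%:E * X `^ q^-1 <= N%:E) = (X <= ((N / lam) `^ q)%:E).
Proof.
move=> X0 lam0 N0 q0; rewrite -lee_pdivlMl // -EFinM (mulrC (lam^-1)%R).
have NL0 : (0 <= N / lam)%R by rewrite divr_ge0 // ltW.
have qn0 : (q != 0)%R by rewrite gt_eqF.
apply/idP/idP => h.
  have := le_poweR _ _ _ q (ltW q0) (poweR_ge0 _ _) h.
  by rewrite -poweRrM mulVf // poweRe1 // poweR_EFin.
have q'0 : (0 <= q^-1)%R by rewrite invr_ge0 ltW.
have := le_poweR _ _ _ q^-1 q'0 X0 h.
by rewrite poweR_EFin -powRrM mulfV // powRr1.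
Qed.

(** On a larger cube containing both given ones the average of [F] is positive, and the A_1
    condition places it below [A * G] at every point. *)
Lemma rdf_lower_bound (F G : Rn -> \bar R) (A : R) a0 l0 : (0 < A)%R -> (0 < l0)%R ->
  (forall x, 0 <= F x) -> measurable_fun setT F -> measurable_fun setT G ->
  (forall x, F x <= G x) -> 0 < \int[leb]_(x in cube a0 l0) F x ->
  (forall b m x, (0 < m)%R -> cube b m x -> cube_avg G b m <= A%:E * G x) ->
  forall b m, (0 < m)%R -> exists2 d : R, (0 < d)%R & forall x, cube b m x -> d%:E <= G x.
Proof.
move=> A0 l00 F0 mF mG FG IF GA b m m0.
have [b' [m' [m'0 sub1 sub2]]] := cube_hull2 _ _ a0 l0 b m (ltW l00) (ltW m0).
pose v := cube_avg F b' m'.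
have v0 : 0 < v.
  rewrite mule_gt0 ?lte_fin ?invr_gt0 ?exprn_gt0 //; apply: (lt_le_trans IF).
  apply: ge0_subset_integral => //; [exact: measurable_cube..|exact: measurable_funTS].
have vG x : cube b m x -> v <= A%:E * G x.
  move=> bx; apply: (le_trans _ (GA b' m' x m'0 (sub2 x bx))).
  by apply: cube_avg_le.
have [r r0 rv] : exists2 r : R, (0 < r)%R & r%:E <= v.
  by case: v v0 {vG} => [r| |] // r0; [exists r|exists 1%R; rewrite ?leey].
exists (r / A)%R; first by rewrite divr_gt0.
move=> x bx; rewrite mulrC EFinM lee_pdivrMl //.
by apply: le_trans rv _; exact: vG.
Qed.

End weights.

(** * Extrapolation to exponents near 1 *)

Section op_norm.
Context (R : realType) (n : nat).
Local Notation Rn := (n.-tuple R).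
Local Notation leb := (lebesgue_n R n).
Local Open Scope ereal_scope.

Lemma measurable_absr_gt (g : Rn -> R) (lam : R) : measurable_fun setT g ->
  measurable [set x | (lam < `|g x|)%R].
Proof.
move=> mg.
have -> : [set x | (lam < `|g x|)%R] = [set x | lam%:E < (`|g x|%R)%:E] by [].
apply: measurable_lte_cst.
by apply: measurableT_comp => //; exact: measurableT_comp.
Qed.

Lemma Lp_norm_le1 (p : R) (w f : Rn -> R) : (0 < p)%R -> (forall x, (0 <= w x)%R) ->
  (Lp_norm p w f <= 1) = (\int[leb]_x ((`|f x| `^ p) * w x)%:E <= 1).
Proof.
move=> p0 w0; rewrite /Lp_norm; set X := \int[leb]_x _.
have X0 : 0 <= X by apply: integral_ge0 => x _; rewrite lee_fin mulr_ge0 // powR_ge0.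
have := weak_bound_iff _ X 1 1 p X0 ltr01 ler01 p0.
by rewrite mul1e divr1 powR1.
Qed.

Lemma measurable_powR_abs (f : Rn -> R) (p : R) : measurable_fun setT f ->
  measurable_fun setT (fun x => (`|f x| `^ p)%:E).
Proof.
move=> mf; apply: measurableT_comp => //.
apply: (measurableT_comp (measurable_powR _)); exact: measurableT_comp.
Qed.

Lemma op_norm_unw_le (p : R) (T : (Rn -> R) -> Rn -> R) (C : R) : (0 < p)%R -> (0 <= C)%R ->
  (forall (f : Rn -> R) (lam : R), measurable_fun setT f -> (0 < lam)%R ->
    \int[leb]_x (`|f x| `^ p)%:E <= 1 ->
    leb [set x | (lam < `|T f x|)%R] <= ((C / lam) `^ p)%:E) ->
  (forall f : Rn -> R, measurable_fun setT f -> measurable_fun setT (T f)) ->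
  op_norm_unw p T <= C%:E.
Proof.
move=> p0 C0 H mT; apply: ge_ereal_sup => _ [f [mf fp] <-].
apply: ge_ereal_sup => _ [lam /= lam0 <-].
rewrite Lp_norm_le1 // in fp.
have mE : measurable [set x | (lam < `|T f x|)%R].
  by apply: measurable_absr_gt; exact: mT.
rewrite weak_bound_iff //; last by apply: integral_ge0 => x _; rewrite lee_fin.
rewrite integral_cst // mul1e; apply: H => //.
by move: fp; under eq_integral do rewrite mulr1.
Qed.

Lemma le_op_norm (p : R) (w : Rn -> R) (T : (Rn -> R) -> Rn -> R) (f : Rn -> R) (N lam : R) :
  (0 < p)%R -> (forall x, (0 <= w x)%R) -> measurable_fun setT f -> (0 <= N)%R -> (0 < lam)%R ->
  \int[leb]_x ((`|f x| `^ p) * w x)%:E <= 1 ->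
  op_norm p w T <= N%:E ->
  \int[leb]_(x in [set x | (lam < `|T f x|)%R]) (w x)%:E <= ((N / lam) `^ p)%:E.
Proof.
move=> p0 w0 mf N0 lam0 fw TN; rewrite -weak_bound_iff //; last first.
  by apply: integral_ge0 => x _; rewrite lee_fin.
apply: le_trans TN; apply: (@le_trans _ _ (weakLp_norm p w (T f))).
  by apply: ereal_sup_ubound; exists lam.
by apply: ereal_sup_ubound; exists f => //; split => //; rewrite Lp_norm_le1.
Qed.

(* On a set where [G <= m] the weight [G^-(p0-p)] is at least [m^-(p0-p)], and
   where [G > m] Chebyshev applies; [m = lam / N] balances the two. *)
Lemma weak_type_extrapolate_down (G : Rn -> \bar R) (E : set Rn) (p p0 N K lam : R) :
  measurable_fun setT G -> (forall x, 0 < G x) -> measurable E ->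
  (0 < p < p0)%R -> (0 < N)%R -> (0 < lam)%R -> (0 <= K)%R ->
  \int[leb]_x G x `^ p <= K%:E ->
  \int[leb]_(x in E) (fine (G x) `^ (- (p0 - p)))%:E <= ((N / lam) `^ p0)%:E ->
  leb E <= ((N / lam) `^ p * (1 + K))%:E.
Proof.
move=> mG G0 mE /andP[p_gt0 pp0] N0 lam0 K0 GK wE.
pose r := (p0 - p)%R; have r0 : (0 < r)%R by rewrite /r; lra.
pose m := (lam / N)%R; have m0 : (0 < m)%R by rewrite divr_gt0.
have -> : leb E = \int[leb]_(x in E) 1 by rewrite integral_cst // mul1e.
have mw : measurable_fun setT (fun x => (fine (G x) `^ (- r))%:E).
  apply: measurableT_comp => //; apply: (measurableT_comp (measurable_powR _)).
  exact: measurableT_comp.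
have mGp : measurable_fun setT (fun x => G x `^ p) by exact: measurable_fun_poweR.
apply: (@le_trans _ _ (\int[leb]_(x in E) ((m `^ r)%:E * (fine (G x) `^ (- r))%:E +
    (m `^ (- p))%:E * G x `^ p))).
  apply: ge0_le_integral => //.
  - apply: measurable_funTS; apply: emeasurable_funD; exact: measurable_funeM.
  - move=> x _; case: (G x) (G0 x) => [g| |] //; last first.
      move=> _; rewrite poweRyr ?gt_eqF // gt0_muley ?lte_fin ?powR_gt0 //.
      by rewrite addey ?leey // -EFinM.
    rewrite lte_fin => g0.
    change (1%:E <= (m `^ r * g `^ (- r) + m `^ (- p) * g `^ p)%:E); rewrite lee_fin.
    have h1 : (0 <= m `^ r * g `^ (- r))%R by rewrite mulr_ge0 ?powR_ge0.
    have h2 : (0 <= m `^ (- p) * g `^ p)%R by rewrite mulr_ge0 ?powR_ge0.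
    case: (leP g m) => gm.
      have : (1 <= m `^ r * g `^ (- r))%R.
        rewrite powRN ler_pdivlMr ?powR_gt0 // mul1r.
        by rewrite ge0_ler_powR // ?nnegrE ltW.
      lra.
    have : (1 <= m `^ (- p) * g `^ p)%R.
      rewrite powRN mulrC ler_pdivlMr ?powR_gt0 // mul1r.
      by rewrite ge0_ler_powR // ?nnegrE ltW.
    lra.
rewrite ge0_integralD //; last 4 first.
- by move=> x _; rewrite mule_ge0 ?lee_fin ?powR_ge0.
- by apply: measurable_funTS; exact: measurable_funeM.
- by move=> x _; rewrite mule_ge0 ?lee_fin ?powR_ge0 // poweR_ge0.
- by apply: measurable_funTS; exact: measurable_funeM.
rewrite !ge0_integralZl_EFin ?powR_ge0 //; last 4 first.
- by move=> x _; rewrite poweR_ge0.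
- exact: measurable_funTS.
- by move=> x _; rewrite lee_fin powR_ge0.
- exact: measurable_funTS.
apply: (@le_trans _ _ ((m `^ r)%:E * ((N / lam) `^ p0)%:E + (m `^ (- p))%:E * K%:E)).
  apply: leeD; apply: lee_wpmul2l; rewrite ?lee_fin ?powR_ge0 //.
  apply: le_trans GK; apply: ge0_subset_integral => // x _; exact: poweR_ge0.
rewrite -!EFinM -EFinD lee_fin mulrDr mulr1.
have mI : (m = (N / lam)^-1)%R by rewrite /m invf_div.
have NL : (0 < N / lam)%R by rewrite divr_gt0.
have mpow s : (m `^ s = (N / lam) `^ (- s))%R.
  by rewrite mI -powR_inv1 ?ltW // -powRrM mulN1r.
rewrite !mpow opprK lerD2r -powRD ?(gt_eqF NL) ?implybT //.
by rewrite (_ : - r + p0 = p)%R //; rewrite /r; lra.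
Qed.

Lemma op_norm_near1 (T : (Rn -> R) -> Rn -> R) (p0 c beta : R) :
  (forall f : Rn -> R, measurable_fun setT f -> measurable_fun setT (T f)) ->
  (1 < p0)%R -> (0 < c)%R -> (0 < beta)%R ->
  (forall w : Rn -> R, in_Ap p0 w -> op_norm p0 w T <= c%:E * poweR (Ap_char p0 w) beta) ->
  exists2 C : R, (0 < C)%R & forall p, (1 < p <= 2)%R -> (p < p0)%R ->
    op_norm_unw p T <= (C * (p - 1) `^ (- (beta * (p0 - 1))))%:E.
Proof.
move=> mT p01 c0 beta0 HT.
have [D D1 HD] := rubio_de_francia R n.
(* [17 = 1 + 16], where [16 = 8 * 2]: the function [F] below has [int F^p <= 2], and its majorant at
   most 8 times as much. *)
pose C := (17 * (c * (2 * D) `^ ((p0 - 1) * beta)))%R.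
have D0 : (0 < D)%R by lra.
have C0 : (0 < C)%R by rewrite !mulr_gt0 // powR_gt0 // mulr_gt0.
exists C => // p p12 pp0; have /andP[p1 p2] := p12.
pose A := (D / (p - 1))%R.
have A1 : (1 <= A)%R by rewrite /A ler_pdivlMr; lra.
pose N := (c * (2 * A) `^ ((p0 - 1) * beta))%R.
have A0 : (0 < A)%R by lra.
have N0 : (0 < N)%R by rewrite mulr_gt0 // powR_gt0 // mulr_gt0.
have -> : (C * (p - 1) `^ (- (beta * (p0 - 1))) = 17 * N)%R.
  have p1' : (0 <= p - 1)%R by lra.
  rewrite /C /N; have -> : (2 * A = 2 * D * (p - 1)^-1)%R by rewrite /A mulrA.
  rewrite [in RHS]powRM ?invr_ge0 // ?mulr_ge0 ?ltW //.
  by rewrite !mulrA -[in RHS]powR_inv1 // -powRrM mulN1r (mulrC beta).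
apply: op_norm_unw_le => //; [lra|by rewrite mulr_ge0 // ltW|].
move=> f lam mf lam0 fp.
pose o : Rn := [tuple 0%R | i < n].
pose Q0 : set Rn := cube o 1.
have mQ0 : measurable Q0 by exact: measurable_cube.
have lebQ0 : leb Q0 = 1 by rewrite lebesgue_cube // expr1n.
(* The indicator of [Q0] keeps [G] away from [0] when [f] vanishes. *)
pose F x := (Num.max `|f x| (\1_Q0 x))%:E.
have F0 x : 0 <= F x by rewrite lee_fin le_max normr_ge0.
have mF : measurable_fun setT F.
  apply: measurableT_comp => //; apply: measurable_maxr.
    exact: measurableT_comp.
  exact: measurable_indic.
have FI : \int[leb]_x F x `^ p <= 2%:E.
  have mi : measurable_fun setT (fun x => (\1_Q0 x : R)%:E).
    by apply: measurableT_comp => //; exact: measurable_indic.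
  have mfp := measurable_powR_abs f p mf.
  apply: (@le_trans _ _ (\int[leb]_x ((`|f x| `^ p)%:E + (\1_Q0 x)%:E))).
    apply: ge0_le_integral => //.
    - by move=> x _; exact: poweR_ge0.
    - exact: measurable_fun_poweR.
    - exact: emeasurable_funD.
    - move=> x _; rewrite /F poweR_EFin -EFinD lee_fin.
      have h1 : (0 <= `|f x| `^ p)%R by rewrite powR_ge0.
      have h2 : (\1_Q0 x `^ p = \1_Q0 x :> R)%R.
        rewrite indicE; case: (_ \in _); first by rewrite powR1.
        by rewrite powR0 // gt_eqF //; lra.
      have h3 : (0 <= \1_Q0 x :> R)%R by [].
      case: (leP `|f x|%R (\1_Q0 x)) => _; rewrite ?h2; lra.
  rewrite ge0_integralD //.
  have -> : \int[leb]_x (\1_Q0 x)%:E = 1 by rewrite integral_indic // setIT; exact: lebQ0.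
  apply: (@le_trans _ _ (1 + 1)); first exact: leeD.
  by rewrite -EFinD lee_fin; lra.
have [G [mG FG GI GA _]] := HD p p12 F F0 mF.
have Gpos : forall b m, (0 < m)%R -> exists2 d : R, (0 < d)%R & forall x, cube b m x -> d%:E <= G x.
  apply: (rdf_lower_bound R n F G A o 1%R A0 ltr01 F0 mF mG FG _ GA).
  apply: (@lt_le_trans _ _ (leb Q0)); first by rewrite lebQ0 lte_fin.
  rewrite (_ : leb Q0 = \int[leb]_(x in Q0) 1); last by rewrite integral_cst // mul1e.
  apply: ge0_le_integral => //; first exact: measurable_funTS.
  by move=> x Qx; rewrite lee_fin le_max indicE mem_set ?lexx ?orbT.
have G0 x : 0 < G x.
  have xx : cube x 1 x by move=> i; rewrite lexx lerDl ler01.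
  by have [d d0 dG] := Gpos x 1%R ltr01; apply: lt_le_trans (dG x xx); rewrite lte_fin.
have GI' : \int[leb]_x G x `^ p <= 16%:E.
  apply: (le_trans GI); apply: (@le_trans _ _ (8%:E * 2%:E)).
    by apply: lee_wpmul2l.
  by rewrite -EFinM lee_fin; lra.
(* Local integrability of [G] follows from that of [G^p] through [g <= 1 + g^p]. *)
have Gfin b m : (0 < m)%R -> cube_avg G b m < +oo.
  move=> m0; have mGp : measurable_fun setT (fun x => G x `^ p) by exact: measurable_fun_poweR.
  have mc := @measurable_cube R n b m.
  have : \int[leb]_(x in cube b m) G x < +oo.
    apply: (@le_lt_trans _ _ (\int[leb]_(x in cube b m) (1 + G x `^ p))).
      apply: ge0_le_integral => //.
      - by move=> x _; exact: ltW.
      - exact: measurable_funTS.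
      - by apply: measurable_funTS; exact: emeasurable_funD.
      - move=> x _; case: (G x) (G0 x) => [g| |] //; last first.
          by rewrite poweRyr ?addey // gt_eqF //; lra.
        rewrite lte_fin => g0; change (g%:E <= (1 + g `^ p)%:E); rewrite lee_fin.
        have := powR_ge0 g p; case: (leP g 1%R) => g1; first by lra.
        have : (g `^ 1 <= g `^ p)%R by apply: ler_powR; lra.
        by rewrite powRr1; lra.
    rewrite ge0_integralD //; last 2 first.
    - by move=> x _; exact: poweR_ge0.
    - exact: measurable_funTS.
    rewrite integral_cst_cube // mul1e; apply: lte_add_pinfty; first by rewrite ltry.
    apply: (@le_lt_trans _ _ 16%:E); last by rewrite ltry.
    apply: le_trans GI'; apply: ge0_subset_integral => // x _; exact: poweR_ge0.
  by rewrite /cube_avg; apply: lte_mul_pinfty => //; rewrite lee_fin invr_ge0 exprn_ge0 // ltW.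
have r01 : (0 < p0 - p < p0 - 1)%R by apply/andP; split; lra.
pose w x := (fine (G x) `^ (- (p0 - p)))%R.
have [ww wA] := Ap_neg_power _ _ G p0 (p0 - p) A mG p01 r01 A1 Gfin Gpos GA.
rewrite -/w in ww wA.
have w0 x : (0 <= w x)%R by exact: powR_ge0.
have ApN : op_norm p0 w T <= N%:E.
  apply: (le_trans (HT w _)); first by split => //; apply: le_lt_trans wA _; rewrite ltry.
  rewrite /N EFinM; apply: lee_wpmul2l; first by rewrite lee_fin ltW.
  have Ap0 : 0 <= Ap_char p0 w.
    apply: (@le_trans _ _ (cube_avg (EFin \o w) o 1 *
         poweR (cube_avg (dual_weight p0 w) o 1) (p0 - 1))).
      apply: mule_ge0; last exact: poweR_ge0.
      by apply: cube_avg_ge0 => // x; rewrite lee_fin.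
    apply: ereal_sup_ubound; exists o => //; exists 1%R => //=.
  have := le_poweR _ _ _ beta (ltW beta0) Ap0 wA.
  by rewrite poweR_EFin -powRrM.
(* Since [G >= |f|], the integrand is at most [|f|^p0 * |f|^-(p0-p) = |f|^p]; where [G] is infinite
   the weight is 0. *)
have fw : \int[leb]_x ((`|f x| `^ p0) * w x)%:E <= 1.
  apply: le_trans fp; apply: ge0_le_integral => //.
  - by move=> x _; rewrite lee_fin mulr_ge0 // powR_ge0.
  - have -> : (fun x => (`|f x| `^ p0 * w x)%:E) = (fun x => (`|f x| `^ p0)%:E * (w x)%:E) by [].
    apply: emeasurable_funM; first exact: measurable_powR_abs.
    by apply: measurableT_comp => //; case: ww => _ [].
  - exact: measurable_powR_abs.
  - move=> x _; rewrite lee_fin /w.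
    have fG : (`|f x|)%:E <= G x.
      by apply: le_trans (FG x); rewrite lee_fin le_max lexx.
    have [f0|fn0] := eqVneq `|f x|%R 0%R.
      by rewrite f0 powR0 ?mul0r ?powR_ge0 // gt_eqF //; lra.
    have fpos : (0 < `|f x|)%R by rewrite lt_neqAle eq_sym fn0 normr_ge0.
    case: (G x) fG (G0 x) => [g| |] //=; last first.
      by move=> _ _; rewrite powR0 ?mulr0 ?powR_ge0 // oppr_eq0 gt_eqF //; lra.
    rewrite lee_fin lte_fin => fg g0.
    apply: (@le_trans _ _ (`|f x| `^ p0 * `|f x| `^ (- (p0 - p)))%R).
      by apply: ler_wpM2l; [exact: powR_ge0|apply: powR_le_neg => //; lra].
    rewrite -powRD ?fn0 ?implybT //.
    by rewrite (_ : p0 + - (p0 - p) = p)%R //; lra.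
have wE := le_op_norm p0 w T f N lam ltac:(lra) w0 mf (ltW N0) lam0 fw ApN.
have mE : measurable [set x | (lam < `|T f x|)%R] by apply: measurable_absr_gt; exact: mT.
apply: (le_trans (weak_type_extrapolate_down G _ p p0 N 16 lam mG G0 mE _ N0 lam0 _ GI' wE)) => //.
  by apply/andP; split; lra.
rewrite lee_fin -mulrA [leRHS]powRM //; last by rewrite divr_ge0 ?ltW.
rewrite mulrC; apply: ler_wpM2r; first exact: powR_ge0.
rewrite (_ : 1 + 16 = 17 `^ 1)%R; last by rewrite powRr1 //; lra.
by apply: ler_powR; lra.
Qed.

End op_norm.

(** * Extrapolation to large exponents *)

Section op_norm_infty.
Context (R : realType) (n : nat).
Local Notation Rn := (n.-tuple R).
Local Notation leb := (lebesgue_n R n).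
Local Open Scope ereal_scope.

(** The test function for large [p] is an indicator divided by a power of the measure of its set,
    which must be finite; continuity from below reduces to that case. *)
Lemma lebesgue_le_exhaust (E : set Rn) (X : \bar R) : measurable E ->
  (forall k : nat, leb (E `&` cube [tuple (- k%:R)%R | i < n] (2 * k%:R)) <= X) ->
  leb E <= X.
Proof.
move=> mE H.
pose Ek k := E `&` cube [tuple (- k%:R)%R | i < n] (2 * k%:R).
have mEk k : measurable (Ek k) by apply: measurableI => //; exact: measurable_cube.
have nd : nondecreasing_seq Ek.
  move=> i j ij; apply/subsetPset => x [Ex hx]; split => // s; have := hx s.
  have : (i%:R <= j%:R :> R)%R by rewrite ler_nat.
  by rewrite !tnth_mktuple => ? /andP[? ?]; apply/andP; split; lra.
have UE : \bigcup_k Ek k = E by rewrite -setI_bigcupr cube_exhaust setIT.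
have := @nondecreasing_cvg_mu _ _ _ leb Ek mEk; rewrite UE => /(_ mE nd) cv.
rewrite -(cvg_lim _ cv) //; apply: lime_le; first by apply/cvg_ex; exists (leb E).
by apply: nearW => k; exact: H.
Qed.

Lemma Ap_char_ge0 (p0 : R) (w : Rn -> R) : (forall x, (0 <= w x)%R) -> 0 <= Ap_char p0 w.
Proof.
move=> w0; pose o : Rn := [tuple 0%R | i < n].
apply: (@le_trans _ _ (cube_avg (EFin \o w) o 1 *
     poweR (cube_avg (dual_weight p0 w) o 1) (p0 - 1))).
  apply: mule_ge0; last exact: poweR_ge0.
  by apply: cube_avg_ge0 => // x; rewrite lee_fin.
by apply: ereal_sup_ubound; exists o => //; exists 1%R => //=.
Qed.

(* Splitting according to whether [g <= y^(p-p0)]; this replaces Hoelder's inequality. *)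
Lemma powR_mul_le_add (y g p0 p : R) : (0 <= y -> 0 <= g -> 0 < p0 -> p0 < p ->
  y `^ p0 * g <= y `^ p + g `^ (p / (p - p0)))%R.
Proof.
move=> y0 g0 p00 p0p.
have h1 := powR_ge0 y p; have h2 := powR_ge0 g (p / (p - p0)).
have pn0 : (p != 0)%R by rewrite gt_eqF //; lra.
case: (leP g (y `^ (p - p0))%R) => h.
  apply: (@le_trans _ _ (y `^ p)%R); last by lra.
  have -> : (y `^ p = y `^ p0 * y `^ (p - p0))%R.
    have e : (p0 + (p - p0) = p)%R by ring.
    by rewrite -powRD e // (negbTE pn0).
  by apply: ler_wpM2l => //; exact: powR_ge0.
apply: (@le_trans _ _ (g `^ (p / (p - p0)))%R); last by lra.
have gp : (0 < g)%R by apply: le_lt_trans h; exact: powR_ge0.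
have d0 : (0 < p - p0)%R by lra.
have r0 : (0 <= p0 / (p - p0))%R by rewrite divr_ge0 // ltW.
have := ge0_ler_powR r0 _ _ (ltW h); rewrite !nnegrE powR_ge0 g0 => /(_ isT isT).
rewrite -powRrM (_ : (p - p0) * (p0 / (p - p0)) = p0)%R; last by field; rewrite gt_eqF.
move=> hy; have -> : (g `^ (p / (p - p0)) = g `^ (p0 / (p - p0)) * g)%R.
  have -> : (p / (p - p0) = p0 / (p - p0) + 1)%R by field; rewrite gt_eqF.
  by rewrite powRD ?(gt_eqF gp) ?implybT // powRr1.
exact: ler_wpM2r.
Qed.

Lemma op_norm_infty (T : (Rn -> R) -> Rn -> R) (p0 c beta : R) :
  (forall f : Rn -> R, measurable_fun setT f -> measurable_fun setT (T f)) ->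
  (1 < p0)%R -> (0 < c)%R -> (0 < beta)%R ->
  (forall w : Rn -> R, in_Ap p0 w -> op_norm p0 w T <= c%:E * poweR (Ap_char p0 w) beta) ->
  exists2 C : R, (0 < C)%R & forall p, (2 * p0 <= p)%R ->
    op_norm_unw p T <= (C * p `^ beta)%:E.
Proof.
move=> mT p01 c0 beta0 HT.
have [D D1 HD] := rubio_de_francia R n.
have D0 : (0 < D)%R by lra.
(* [9 = 1 + 8]: the product [|f|^p0 * G] is at most [|f|^p + G^q], whose integrals are at most 1 and
   8. *)
pose C := (9 * (c * D `^ beta))%R.
have C0 : (0 < C)%R by rewrite !mulr_gt0 // powR_gt0.
exists C => // p pp0.
pose A := (D * p)%R; have A1 : (1 <= A)%R by rewrite /A; nra.
have A0 : (0 < A)%R by lra.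
pose N := (c * A `^ beta)%R; have N0 : (0 < N)%R by rewrite mulr_gt0 // powR_gt0.
have -> : (C * p `^ beta = 9 * N)%R.
  by rewrite /C /N /A powRM ?mulrA //; lra.
apply: op_norm_unw_le => //; [lra|by rewrite mulr_ge0 // ltW|].
move=> f lam mf lam0 fp.
set E := [set x | _].
have mE : measurable E by apply: measurable_absr_gt; exact: mT.
apply: lebesgue_le_exhaust => // k.
set Q := cube _ _; set E' := E `&` Q.
have mQ : measurable Q by exact: measurable_cube.
have mE' : measurable E' by exact: measurableI.
have k0 : (0 <= 2 * k%:R :> R)%R by rewrite mulr_ge0.
have [v v0 Ev] : exists2 v : R, (0 <= v)%R & leb E' = v%:E.
  have : leb E' <= leb Q by apply: le_measure; rewrite ?inE //; exact: subIsetr.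
  rewrite [X in _ <= X](_ : _ = ((2 * k%:R) ^+ n)%:E); last exact: lebesgue_cube.
  have : 0 <= leb E' by [].
  by case: (leb E') => [v| |] //; rewrite lee_fin; exists v.
have [->|vn0] := eqVneq (leb E') 0; first by rewrite lee_fin powR_ge0.
have {v0 vn0} v0 : (0 < v)%R.
  by rewrite lt_neqAle v0 andbT eq_sym; move: vn0; rewrite Ev eqe.
pose q := (p / (p - p0))%R.
have q12 : (1 < q <= 2)%R.
  by rewrite /q ltr_pdivlMr ?ler_pdivrMr; [apply/andP; split; lra|lra|lra].
have /andP[q1 q2] := q12.
(* [1 / (q - 1) = (p - p0) / p0] is at most [p]: the A_1 constant grows linearly in [p]. *)
have Aq : (D / (q - 1) <= A)%R.
  have -> : (q - 1 = p0 / (p - p0))%R by rewrite /q; field; rewrite gt_eqF //; lra.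
  rewrite /A invf_div ler_pM2l // ler_pdivrMr; nra.
pose s := (v `^ (- q^-1))%R; have s0 : (0 < s)%R by rewrite powR_gt0.
pose F x := (s * \1_E' x)%:E.
have F0 x : 0 <= F x by rewrite lee_fin mulr_ge0 // ltW.
have mF : measurable_fun setT F.
  apply: measurableT_comp => //; apply: measurable_funM => //; exact: measurable_indic.
have FI : \int[leb]_x F x `^ q = 1.
  have -> : (fun x => F x `^ q) = (fun x => (s `^ q)%:E * (\1_E' x)%:E).
    apply/funext => x; rewrite /F poweR_EFin -EFinM; congr EFin.
    rewrite indicE; case: (_ \in _); first by rewrite !mulr1.
    by rewrite !mulr0 powR0 // gt_eqF //; lra.
  rewrite integral_cst_indic ?powR_ge0 // Ev -EFinM; congr EFin.
  rewrite /s -powRrM mulNr mulVf; last by rewrite gt_eqF //; lra.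
  by rewrite powR_inv1 ?mulVf ?ltW // gt_eqF.
have [G [mG FG GI GA Gbd]] := HD q q12 F F0 mF.
have GI8 : \int[leb]_x G x `^ q <= 8%:E by rewrite FI mule1 in GI.
have G0 x : 0 <= G x by apply: le_trans (F0 x) (FG x).
(* [F] is bounded by [s], so the last clause of [rubio_de_francia] applies and [fine] loses nothing
   in the weight below. *)
have Gfin x : G x \is a fin_num.
  rewrite ge0_fin_numE //; apply: (@le_lt_trans _ _ (2 * s)%:E); last by rewrite ltry.
  by apply: Gbd => y; rewrite lee_fin indicE; case: (_ \in _); rewrite ?mulr1 ?mulr0 ?(ltW s0).
have GA' b m x : (0 < m)%R -> cube b m x -> cube_avg G b m <= A%:E * G x.
  move=> m0 bx; apply: (le_trans (GA b m x m0 bx)).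
  by apply: lee_wpmul2r => //; rewrite lee_fin.
(* As [T] need not be homogeneous, [w] is scaled so that [f] lies in the unit ball of
   [L^p0(w)]; the [A_p] characteristic does not see the factor. *)
pose w x := (9^-1 * fine (G x))%R.
have Ew x : (w x)%:E = (9^-1)%:E * G x by rewrite /w EFinM fineK.
have EwE : EFin \o w = (fun x => (9^-1)%:E * G x) by apply/funext => x; exact: Ew.
have w0 x : (0 <= w x)%R by rewrite mulr_ge0 ?invr_ge0 // fine_ge0.
have mw : measurable_fun setT w.
  by apply: measurable_funM => //; exact: measurableT_comp.
have n9 : (0 <= 9^-1 :> R)%R by rewrite invr_ge0.
have Gpos : forall b m, (0 < m)%R -> exists2 d : R, (0 < d)%R & forall x, cube b m x -> d%:E <= G x.
  pose o : Rn := [tuple (- k%:R)%R | i < n].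
  (* The side is enlarged by 1 to be positive also for [k = 0]. *)
  have l0 : (0 < 2 * k%:R + 1 :> R)%R by lra.
  apply: (rdf_lower_bound R n F G A o (2 * k%:R + 1)%R A0 l0 F0 mF mG FG _ GA').
  apply: (@lt_le_trans _ _ (\int[leb]_(x in E') F x)); last first.
    apply: ge0_subset_integral => //; [exact: measurable_cube|exact: measurable_funTS|].
    by move=> x [_ hx] i; have /andP[? ?] := hx i; apply/andP; split; lra.
  have -> : \int[leb]_(x in E') F x = \int[leb]_(x in E') s%:E.
    by apply: eq_integral => x xE; rewrite /F indicE xE mulr1.
  rewrite integral_cst //; change (0 < s%:E * leb E'); rewrite Ev -EFinM lte_fin.
  exact: mulr_gt0.
have wpos b m : (0 < m)%R -> exists2 d : R, (0 < d)%R & forall x, cube b m x -> (d <= w x)%R.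
  move=> m0; have [d d0 dG] := Gpos b m m0; exists (9^-1 * d)%R; first by rewrite mulr_gt0.
  move=> x bx; rewrite -lee_fin Ew EFinM; apply: lee_wpmul2l; rewrite ?lee_fin //; exact: dG.
have wA1 b m x : (0 < m)%R -> cube b m x -> cube_avg (EFin \o w) b m <= (A * w x)%:E.
  move=> m0 bx; rewrite EwE cube_avgZ // (EFinM A) Ew [leRHS]muleCA.
  by apply: lee_wpmul2l; rewrite ?lee_fin //; exact: GA'.
have [ww wA] := Ap_of_A1 R n w p0 A mw p01 A1 wpos wA1.
have ApN : op_norm p0 w T <= N%:E.
  apply: (le_trans (HT w _)); first by split => //; apply: le_lt_trans wA _; rewrite ltry.
  rewrite /N (EFinM c); apply: lee_wpmul2l; first by rewrite lee_fin ltW.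
  have := le_poweR _ _ _ beta (ltW beta0) (Ap_char_ge0 p0 w w0) wA.
  by rewrite poweR_EFin.
have fw : \int[leb]_x ((`|f x| `^ p0) * w x)%:E <= 1.
  have -> : (fun x => (`|f x| `^ p0 * w x)%:E) = (fun x => (9^-1)%:E * ((`|f x| `^ p0)%:E * G x)).
    by apply/funext => x; rewrite muleCA -Ew -EFinM.
  have mfp0 := measurable_powR_abs R n f p0 mf.
  have mfp := measurable_powR_abs R n f p mf.
  have mGq : measurable_fun setT (fun x => G x `^ q) by exact: measurable_fun_poweR.
  rewrite ge0_integralZl_EFin //; last 2 first.
  - by move=> x _; rewrite mule_ge0 // lee_fin powR_ge0.
  - exact: emeasurable_funM.
  rewrite lee_pdivrMl // mule1.
  apply: (@le_trans _ _ (\int[leb]_x ((`|f x| `^ p)%:E + G x `^ q))).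
    apply: ge0_le_integral => //.
    - by move=> x _; rewrite mule_ge0 // lee_fin powR_ge0.
    - exact: emeasurable_funM.
    - exact: emeasurable_funD.
    - move=> x _; rewrite -(fineK (Gfin x)) poweR_EFin -EFinM -EFinD lee_fin.
      by apply: powR_mul_le_add; [exact: normr_ge0|exact: fine_ge0|lra|lra].
  rewrite ge0_integralD //; last by move=> x _; exact: poweR_ge0.
  apply: (@le_trans _ _ (1 + 8%:E)); first exact: leeD.
  by rewrite -EFinD lee_fin; lra.
have wE := le_op_norm R n p0 w T f N lam ltac:(lra) w0 mf (ltW N0) lam0 fw ApN.
(* On [E'] the weight is at least [s / 9], and [s * v = v^(1 - 1/q) = v^(p0/p)]. *)
have wE' : (9^-1 * v `^ (p0 / p))%:E <= ((N / lam) `^ p0)%:E.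
  apply: le_trans wE.
  have mEw : measurable_fun setT (fun x => (w x)%:E) by exact: measurableT_comp.
  apply: (@le_trans _ _ (\int[leb]_(x in E') (w x)%:E)); last first.
    apply: (ge0_subset_integral leb mE' mE) => [|x _|x []//].
      exact: measurable_funTS.
    by rewrite lee_fin.
  have -> : (9^-1 * v `^ (p0 / p))%:E = \int[leb]_(x in E') (9^-1 * s)%:E.
    rewrite integral_cst //; change ((9^-1 * v `^ (p0 / p))%:E = (9^-1 * s)%:E * leb E').
    rewrite Ev -EFinM -mulrA; congr (_ * _)%:E.
    rewrite -[X in (s * X)%R]powRr1 ?ltW // /s -powRD ?(gt_eqF v0) ?implybT //.
    by congr (_ `^ _)%R; rewrite /q invf_div; field; rewrite gt_eqF //; lra.
  apply: ge0_le_integral => //.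
  - by move=> x _; rewrite lee_fin mulr_ge0 // ltW.
  - exact: measurable_funTS.
  - move=> x xE; rewrite Ew EFinM; apply: lee_wpmul2l; first by rewrite lee_fin.
    by apply: le_trans (FG x); rewrite /F lee_fin indicE mem_set // mulr1.
rewrite Ev lee_fin; rewrite lee_fin in wE'.
have NL : (0 <= N / lam)%R by rewrite divr_ge0 ?ltW.
have p00 : (0 < p0)%R by lra.
have p_gt0 : (0 < p)%R by lra.
have h1 : (v `^ (p0 / p) <= (9 * (N / lam)) `^ p0)%R.
  rewrite powRM //; move: wE'; rewrite ler_pdivrMl // => h.
  apply: (le_trans h); apply: ler_wpM2r; first exact: powR_ge0.
  rewrite -[leLHS]powRr1 //; apply: ler_powR; lra.
have r0 : (0 <= p / p0)%R by rewrite divr_ge0 ?ltW.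
have := ge0_ler_powR r0 _ _ h1; rewrite !nnegrE !powR_ge0 => /(_ isT isT).
rewrite -!powRrM.
have -> : (p0 / p * (p / p0) = 1)%R by field; rewrite !gt_eqF.
have -> : (p0 * (p / p0) = p)%R by field; rewrite gt_eqF.
by rewrite (powRr1 (ltW v0)) mulrA.
Qed.

End op_norm_infty.

(** * From growth rates to [alpha_T] and [gamma_T] *)

Lemma limf_esup_neqy (T : choiceType) (X : filteredType T) (R : realType) (f : X -> \bar R)
  (F : set (set X)) (V : set X) (M : R) :
  F V -> (forall x, V x -> (f x <= M%:E)%E) -> limf_esup f F <> +oo%E.
Proof.
move=> FV fM h; have : (limf_esup f F <= M%:E)%E.
  apply: (@le_trans _ _ (ereal_sup (f @` V))).
    by apply: ereal_inf_lbound; exists V.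
  by apply: ge_ereal_sup => _ [x Vx <-]; exact: fM.
by rewrite h.
Qed.

Theorem theorem1p1 (R : realType) (n : nat)
    (T : (n.-tuple R -> R) -> n.-tuple R -> R) (p0 c beta : R) :
  (0 < n)%N ->
  (forall f : n.-tuple R -> R, measurable_fun setT f -> measurable_fun setT (T f)) ->
  1 < p0 -> 0 < c -> 0 < beta ->
  (forall w : n.-tuple R -> R, in_Ap p0 w ->
     (op_norm p0 w T <= c%:E * poweR (Ap_char p0 w) beta)%E) ->
  (maxe (gamma_T T) (alpha_T T * ((p0 - 1)^-1)%:E) <= beta%:E)%E.
Proof.
move=> _ mT p01 c0 beta0 HT.
have beta0' := ltW beta0.
rewrite ge_max; apply/andP; split.
  have [C C0 HC] := op_norm_infty R n T p0 c beta mT p01 c0 beta0 HT.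
  rewrite /gamma_T ge_max lee_fin beta0' /=.
  apply: ge_ereal_sup => _ [g [g0 Hg] <-]; rewrite lee_fin leNgt; apply/negP => bg.
  (* With [eps] equal to the whole excess, [g - eps] is [beta], and the quotient in [gamma_T] is
     bounded by [C] instead of having infinite limsup. *)
  have eps0 : 0 < g - beta by rewrite subr_gt0.
  have := Hg _ eps0; apply: (limf_esup_neqy _ _ _ _ _ [set p : R^o | 2 * p0 < p] C).
    by apply: nbhs_pinfty_gt; exact: num_real.
  move=> p /= pp0; have p_gt0 : 0 < p by lra.
  rewrite subKr muleC lee_pdivrMl ?powR_gt0 // -EFinM mulrC.
  by apply: HC; exact: ltW.
have p00 : 0 < p0 - 1 by lra.
rewrite muleC lee_pdivrMl // -EFinM.
have [C C0 HC] := op_norm_near1 R n T p0 c beta mT p01 c0 beta0 HT.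
rewrite /alpha_T ge_max lee_fin mulr_ge0 ?(ltW p00) //=.
apply: ge_ereal_sup => _ [a [a0 Ha] <-]; rewrite lee_fin leNgt; apply/negP => ba.
(* The same choice at 1: [(p-1)^(a - eps)] exactly compensates the growth of the norm. *)
have eps0 : 0 < a - (p0 - 1) * beta by rewrite subr_gt0.
have := Ha _ eps0; apply: (limf_esup_neqy _ _ _ _ _ [set p : R^o | 1 < p < Num.min 2 p0] C).
  have m1 : 1 < Num.min 2 p0 by rewrite lt_min p01 ltr1n.
  near=> p; apply/andP; split; near: p; [exact: nbhs_right_gt|exact: nbhs_right_lt].
move=> p /= /andP[p1]; rewrite lt_min => /andP[p2 pp0].
have p1' : 0 < p - 1 by lra.
rewrite subKr muleC -lee_pdivlMr ?powR_gt0 //.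
rewrite -EFinM -powRN mulrC [(p0 - 1) * beta]mulrC mulrC; apply: HC => //.
by rewrite p1 ltW.
Unshelve. all: by end_near.
Qed.
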